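(* Let $A$ be a naive-cellular algebra over a commutative ring $R$, with naive-cellular datum $(\Lambda, G, M, C, * )$. Let $Y \subset X$ be downward closed subsets of $\Lambda$, with $X \setminus Y$ finite. Suppose that for each $\lambda \in X \setminus Y$ the following holds: for every $q \in M(\lambda)$ there exists $v \in W(\lambda)$ such that for some $\sigma \in G(\lambda)$ we have, for all $\tau\in G(\lambda)$, $$\langle C_q, v \rangle_{\tau} = \begin{cases} 1 & \text{if } \tau=\sigma,\\ 0 & \text{otherwise.}\end{cases}$$ Then, for any right $A$-module $P$ and any left $A$-module $N$ such that $I_X$ acts trivially (i.e. by zero) on both, we have $$\mathrm{Tor}_*^{A/I_{Y}}(P,N) \cong \mathrm{Tor}_*^{A/I_{X}}(P,N).$$
   Context: $R$ is a commutative ring with unit. A naive-cellular algebra over $R$ is an associative unital $R$-algebra $A$ together with a naive-cellular datum $(\Lambda,G,M,C,* )$, where: (W1) $\Lambda$ is a poset; for each $\lambda\in\Lambda$, $G(\lambda)$ is a group and $M(\lambda)$ is a finite set (the link states of type $\lambda$), such that the map $\coprod_{\lambda\in\Lambda} M(\lambda)\times G(\lambda)\times M(\lambda)\to A$, $(p,\sigma,q)\mapsto C_{p,q}^{\sigma}$, is injective with image an $R$-basis of $A$. (W2) $*$ is an $R$-linear anti-involution of $A$ with $(C_{p,q}^{\sigma})^*=C_{q,p}^{\sigma^{-1}}$. (W3) If $\sigma\in G(\lambda)$ and $p,q\in M(\lambda)$, then for any $a\in A$ we have $aC_{p,q}^{\sigma}\equiv\sum_{\sigma'\in G(\lambda),\,p'\in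 M(\lambda)} r_a(p',\sigma'\sigma^{-1},p)\,C_{p',q}^{\sigma'} \pmod{I_{<\lambda}}$, where $r_a(p',\sigma'\sigma^{-1},p)\in R$ depends only on $a,p',p$ and the product $\sigma'\sigma^{-1}$, and $I_{<\lambda}$ is the $R$-span of the $C_{p'',q''}^{\tau}$ with $\mu<\lambda$, $\tau\in G(\mu)$, $p'',q''\in M(\mu)$. A subset $X$ of a poset $\Lambda$ is downward closed if $\mu\le\lambda$ and $\lambda\in X$ imply $\mu\in X$. For $X\subset\Lambda$, $I_X$ is the $R$-span of the $C_{p,q}^{\sigma}$ with $\mu\in X$, $\sigma\in G(\mu)$, $p,q\in M(\mu)$; if $X$ is downward closed then $I_X$ is a two-sided ideal of $A$. The link module $W(\lambda)$ is the free $R$-module on symbols $C_p$, $p\in M(\lambda)$, with left $A$-action $aC_p=\sum_{\sigma'\in G(\lambda),\,p'\in M(\lambda)} r_a(p',\sigma',p)C_{p'}$. For $\tau\in G(\lambda)$, the bilinear form $\langle\ ,\ \rangle_\tau$ on $W(\lambda)$ is the $R$-bilinear extension of: $\langle C_q,C_p\rangle_\tau := r_{C_{p_1,q}^{1}}(p_1,\tau,p)$, which is independent of $p_1\in M(\lambda)$; equivalently, it is the coefficient of $C_{p_1,q_2}^{\tau}$ in the product $C_{p_1,q}^{1}C_{p,q_2}^{1}$ for any $p_1,q_2\in M(\lambda)$. Since $I_Y\subset I_X$ acts trivially, $P$ and $N$ are modules over $A/I_Y$ and over $A/I_X$. *)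

(* Defs.v *)
From HB Require Import structures.
From mathcomp Require Import all_boot all_order all_algebra.
From mathcomp Require Import finmap.
From mathcomp Require Import boolp classical_sets functions cardinality fsbigop.
Set Implicit Arguments.
Unset Strict Implicit.
Unset Printing Implicit Defensive.
Import GRing.Theory.
Local Open Scope ring_scope.
Local Open Scope classical_set_scope.

Section Submodules.
Variables (K : pzRingType) (V : lmodType K).

Record submodule := Submodule {
  sm_set :> V -> Prop;
  sm_0 : sm_set 0;
  sm_lin : forall (k : K) (x y : V), sm_set x -> sm_set y -> sm_set (k *: x + y)
}.

Definition sm_pred (U : submodule) : {pred V} := fun x => `[< U x >].

Lemma sm_predP (U : submodule) x : reflect (U x) (x \in sm_pred U).
Proof. exact: asboolP. Qed.

Lemma sm_pred_closed (U : submodule) : submod_closed (sm_pred U).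
Proof.
split; first by apply/sm_predP/sm_0.
by move=> k x y /sm_predP xU /sm_predP yU; apply/sm_predP/sm_lin.
Qed.
HB.instance Definition _ (U : submodule) :=
  GRing.isSubmodClosed.Build K V (sm_pred U) (sm_pred_closed U).

Definition subm (U : submodule) : Type := {x : V | x \in sm_pred U}.
HB.instance Definition _ U := SubChoice.on (subm U).
HB.instance Definition _ U := [SubChoice_isSubLmodule of subm U by <:].

Definition quom (U : submodule) : Type := Quotient.quot (sm_pred U).
HB.instance Definition _ U := GRing.Zmodule.on (quom U).

Definition quom_pi (U : submodule) (x : V) : quom U :=
  \pi_(Quotient.quot (sm_pred U))%qT x.
Definition quom_repr (U : submodule) (z : quom U) : V :=
  generic_quotient.repr (z : Quotient.quot (sm_pred U)).

Lemma quom_reprK U : cancel (@quom_repr U) (quom_pi U).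
Proof. by move=> z; apply: generic_quotient.reprK. Qed.

Lemma quom_piP U x y : quom_pi U x = quom_pi U y <-> U (x - y).
Proof.
have -> : U (x - y) = (x - y \in sm_pred U) by apply/propext; split=> /sm_predP.
rewrite (Quotient.idealrBE (sm_pred U)); split=> [xy|/eqP//]; exact/eqP.
Qed.

Lemma quom_piD U x y : quom_pi U (x + y) = quom_pi U x + quom_pi U y.
Proof. exact: (Quotient.pi_add (sm_pred U)). Qed.

Definition quom_scale U (k : K) (z : quom U) : quom U :=
  quom_pi U (k *: quom_repr z).

Lemma quom_piZ U k x : quom_pi U (k *: x) = quom_scale k (quom_pi U x).
Proof.
apply/quom_piP; rewrite -scalerBr -[_ *: _]addr0; apply: sm_lin (sm_0 U).
by apply/quom_piP; rewrite quom_reprK.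
Qed.

Lemma quom_scaleA U k l (z : quom U) :
  quom_scale k (quom_scale l z) = quom_scale (k * l) z.
Proof. by rewrite -[z]quom_reprK -!quom_piZ scalerA. Qed.
Lemma quom_scale1 U : left_id 1 (@quom_scale U).
Proof. by move=> z; rewrite -[z]quom_reprK -!quom_piZ scale1r. Qed.
Lemma quom_scaleDr U : right_distributive (@quom_scale U) +%R.
Proof.
move=> k y z; rewrite -[y]quom_reprK -[z]quom_reprK.
by rewrite -quom_piD -!quom_piZ -quom_piD scalerDr.
Qed.
Lemma quom_scaleDl U (z : quom U) :
  {morph (@quom_scale U)^~ z : k l / k + l}.
Proof.
by move=> k l; rewrite -[z]quom_reprK -!quom_piZ -quom_piD scalerDl.
Qed.
HB.instance Definition _ U := GRing.Zmodule_isLmodule.Build K (quom U)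
  (@quom_scaleA U) (@quom_scale1 U) (@quom_scaleDr U) (@quom_scaleDl U).

Lemma quom_pi_linear U : linear (quom_pi U).
Proof. by move=> k x y; rewrite quom_piD quom_piZ. Qed.
HB.instance Definition _ U :=
  GRing.isLinear.Build K V (quom U) _ (quom_pi U) (@quom_pi_linear U).

Definition in_span (B : set V) (x : V) : Prop :=
  exists (n : nat) (k : 'I_n -> K) (v : 'I_n -> V),
    (forall i, B (v i)) /\ x = \sum_(i < n) k i *: v i.

Lemma in_span0 B : in_span B 0.
Proof.
by exists 0%N, (fun=> 0), (fun=> 0); split=> [[]//|]; rewrite big_ord0.
Qed.

Lemma in_span_lin B k x y :
  in_span B x -> in_span B y -> in_span B (k *: x + y).
Proof.
move=> [m [a [v [Bv ->]]]] [n [b [w [Bw ->]]]].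
exists (m + n)%N,
  (fun i => match fintype.split i with inl j => k * a j | inr j => b j end),
  (fun i => match fintype.split i with inl j => v j | inr j => w j end).
split=> [i|]; first by case: fintype.split.
rewrite big_split_ord scaler_sumr /=; congr (_ + _); apply: eq_bigr => i _.
  by rewrite (unsplitK (inl i)) scalerA.
by rewrite (unsplitK (inr i)).
Qed.
Definition spanm B := Submodule (in_span0 B) (@in_span_lin B).

Lemma span_gen (B : set V) x : B x -> spanm B x.
Proof.
move=> Bx; exists 1%N, (fun=> 1), (fun=> x); split=> //.
by rewrite big_ord1 scale1r.
Qed.

Lemma span_min (B : set V) (U : submodule) :
  (forall x, B x -> U x) -> forall x, spanm B x -> U x.
Proof.
move=> BU x [n [k [v [Bv ->]]]]; elim/big_ind: _ => [|y z Uy Uz|i _].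
- exact: sm_0.
- by rewrite -[y]scale1r; apply: sm_lin.
- by rewrite -[_ *: _]addr0; apply: sm_lin (sm_0 U); apply: BU.
Qed.

Definition is_basis (B : set V) : Prop :=
  (forall x, spanm B x) /\
  (forall (n : nat) (k : 'I_n -> K) (v : 'I_n -> V),
     injective v -> (forall i, B (v i)) ->
     \sum_(i < n) k i *: v i = 0 -> forall i, k i = 0).

End Submodules.

Section LinearMaps.
Variables (K : pzRingType) (V W : lmodType K) (f : {linear V -> W}).

Lemma ker_lin k x y : f x = 0 -> f y = 0 -> f (k *: x + y) = 0.
Proof. by move=> fx fy; rewrite linearP fx fy scaler0 addr0. Qed.
Definition ker_sub : submodule V :=
  Submodule (sm_set := fun x => f x = 0) (linear0 f) ker_lin.

Lemma im0 : exists x, f x = 0. Proof. by exists 0; rewrite linear0. Qed.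
Lemma im_lin k y z : (exists x, f x = y) -> (exists x, f x = z) ->
  exists x, f x = k *: y + z.
Proof. by move=> [u <-] [v <-]; exists (k *: u + v); rewrite linearP. Qed.
Definition im_sub : submodule W :=
  Submodule (sm_set := fun y => exists x, f x = y) im0 im_lin.

Lemma comap0 (U : submodule W) : U (f 0).
Proof. by rewrite linear0; apply: sm_0. Qed.
Lemma comap_lin (U : submodule W) k x y :
  U (f x) -> U (f y) -> U (f (k *: x + y)).
Proof. by rewrite linearP; apply: sm_lin. Qed.
Definition comap_sub (U : submodule W) : submodule V :=
  Submodule (sm_set := fun x => U (f x)) (comap0 U) (@comap_lin U).

(* The factorisation of f through V / U when f kills U. *)
Definition quom_lift (U : submodule V) (fU : forall x, U x -> f x = 0)
  (z : quom U) : W := f (quom_repr z).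

Lemma quom_liftE U fU x : @quom_lift U fU (quom_pi U x) = f x.
Proof.
apply/eqP; rewrite -subr_eq0 -linearB; apply/eqP/fU/quom_piP.
by rewrite quom_reprK.
Qed.

Lemma quom_lift_linear U fU : linear (@quom_lift U fU).
Proof.
move=> k y z; rewrite -[y]quom_reprK -[z]quom_reprK -linearP.
by rewrite !quom_liftE linearP.
Qed.
HB.instance Definition _ U fU := GRing.isLinear.Build K (quom U) W _
  (@quom_lift U fU) (@quom_lift_linear U fU).

End LinearMaps.

Lemma full_lin (K : pzRingType) (V : lmodType K) (k : K) (x y : V) :
  setT x -> setT y -> setT (k *: x + y).
Proof. by []. Qed.
Definition full_sub (K : pzRingType) (V : lmodType K) : submodule V :=
  Submodule (sm_set := setT) (I : setT 0) (@full_lin K V).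

Definition mod_iso (K : pzRingType) (V W : lmodType K) : Prop :=
  exists f : {linear V -> W}, bijective f.

Section FreeModule.
Variables (K : pzRingType) (T : choiceType).

Definition has_finsupp (f : T -> K^o) : Prop := finite_set [set t | f t != 0].

Lemma finsupp0 : has_finsupp 0.
Proof.
by apply: (sub_finite_set (B := set0)) => // t /=; rewrite eqxx.
Qed.

Lemma finsupp_lin (k : K) (f g : T -> K^o) :
  has_finsupp f -> has_finsupp g -> has_finsupp (k *: f + g).
Proof.
move=> ff fg; apply: (sub_finite_set
  (B := [set t | f t != 0] `|` [set t | g t != 0])).
  move=> t /= fgt; apply/orP; apply: contraNT fgt.
  rewrite negb_or !negbK => /andP[/eqP ft /eqP gt].
  by rewrite addrfctE scalrfctE ft gt scaler0 addr0.
by rewrite finite_setU.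
Qed.

Definition finsupp_sub := Submodule finsupp0 finsupp_lin.
Definition freem : Type := subm finsupp_sub.
HB.instance Definition _ := GRing.Lmodule.on freem.

Definition fcoef (x : freem) (t : T) : K := (val x : T -> K^o) t.

Lemma fcoef_fin x : finite_set [set t | fcoef x t != 0].
Proof. exact: (elimT (sm_predP _ _) (valP x)). Qed.

Lemma fcoefP k x y t : fcoef (k *: x + y) t = k * fcoef x t + fcoef y t.
Proof. by []. Qed.

Lemma fcoef_inj x y : fcoef x =1 fcoef y -> x = y.
Proof. by move=> xy; apply/val_inj/funext. Qed.

Lemma fgen_fin (t : T) : has_finsupp (fun u => (u == t)%:R).
Proof.
apply: (sub_finite_set (B := [set t])); last exact: finite_set1.
by move=> u /=; have [//|_] := eqVneq u t; rewrite eqxx.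
Qed.
Definition fgen (t : T) : freem :=
  Sub (fun u => (u == t)%:R) (introT (sm_predP finsupp_sub _) (fgen_fin t)).

Lemma fcoef_gen t u : fcoef (fgen t) u = (u == t)%:R.
Proof. by []. Qed.

(* The linear extension of g : T -> V. *)
Definition flift (V : lmodType K) (g : T -> V) (x : freem) : V :=
  \sum_(t \in [set: T]) fcoef x t *: g t.

Lemma fliftE (V : lmodType K) (g : T -> V) (x : freem) (A : {fset T}) :
  [set t | fcoef x t != 0] `<=` [set` A] ->
  flift g x = \sum_(t <- A) fcoef x t *: g t.
Proof.
move=> xA; rewrite /flift (fsbigTE A) // => t tA.
have [->|xt] := eqVneq (fcoef x t) 0; first by rewrite scale0r.
by have /= := xA _ xt; rewrite (negPf tA).
Qed.

Lemma flift_linear (V : lmodType K) (g : T -> V) : linear (flift g).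
Proof.
move=> k x y.
have /finite_fsetP[A AE] :
    finite_set ([set t | fcoef x t != 0] `|` [set t | fcoef y t != 0]).
  by rewrite finite_setU; split; apply: fcoef_fin.
have xA : [set t | fcoef x t != 0] `<=` [set` A] by rewrite -AE; left.
have yA : [set t | fcoef y t != 0] `<=` [set` A] by rewrite -AE; right.
rewrite (fliftE _ xA) (fliftE _ yA) (@fliftE _ _ _ A) => [|t /= xyt].
  rewrite scaler_sumr -big_split; apply: eq_bigr => t _ /=.
  by rewrite fcoefP scalerDl scalerA.
apply: contraNT xyt => tA; rewrite fcoefP.
have [->|xt] := eqVneq (fcoef x t) 0; last first.
  by have /= := xA _ xt; rewrite (negPf tA).
have [->|yt] := eqVneq (fcoef y t) 0; last first.
  by have /= := yA _ yt; rewrite (negPf tA).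
by rewrite mulr0 addr0.
Qed.
HB.instance Definition _ (V : lmodType K) (g : T -> V) :=
  GRing.isLinear.Build K freem V _ (flift g) (flift_linear g).

Lemma flift_gen (V : lmodType K) (g : T -> V) t : flift g (fgen t) = g t.
Proof.
rewrite (@fliftE _ _ _ [fset t]%fset) ?big_seq_fset1.
  by rewrite fcoef_gen eqxx scale1r.
by move=> u /=; rewrite fcoef_gen inE; have [//|_] := eqVneq u t;
   rewrite eqxx.
Qed.

Lemma free_sum (x : freem) : flift fgen x = x.
Proof.
have /finite_fsetP[A AE] := fcoef_fin x.
rewrite (@fliftE _ _ _ A) ?AE //; apply: fcoef_inj => t.
have cs (s : seq T) : fcoef (\sum_(u <- s) fcoef x u *: fgen u) t =
    \sum_(u <- s) fcoef x u * (t == u)%:R.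
  elim: s => [|u s IH]; first by rewrite !big_nil.
  by rewrite !big_cons fcoefP IH.
rewrite cs; case: (boolP (t \in A)) => tA.
  rewrite (big_rem t) //= eqxx mulr1 big_seq big1 ?addr0 // => u.
  rewrite mem_rem_uniq ?fset_uniq // inE eq_sym => /andP[/negPf-> _].
  by rewrite mulr0.
rewrite big_seq big1 => [|u uA].
  by apply/esym/eqP; apply: contraNT tA => xt; have : [set` A] t by rewrite -AE.
by case: eqVneq tA => [->|_ _]; rewrite ?uA // mulr0.
Qed.

Lemma flift_unique (V : lmodType K) (f : {linear freem -> V}) x :
  f x = flift (fun t => f (fgen t)) x.
Proof.
have /finite_fsetP[A AE] := fcoef_fin x.
rewrite -{1}[x]free_sum !(@fliftE _ _ _ A) ?AE // linear_sum.
by apply: eq_bigr => t _; rewrite linearZ.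
Qed.

End FreeModule.
Arguments fgen {K T} t.

Definition projective (K : pzRingType) (F : lmodType K) : Prop :=
  forall (V W : lmodType K) (g : {linear V -> W}) (f : {linear F -> W}),
    (forall w, exists v, g v = w) ->
    exists h : {linear F -> V}, forall x, g (h x) = f x.

Lemma free_projective (K : pzRingType) (T : choiceType) :
  projective (freem K T).
Proof.
move=> V W g f gsurj; have [s sK] := choice gsurj.
exists (flift (fun t => s (f (fgen t)))) => x /=.
rewrite [RHS]flift_unique [LHS](flift_unique (g \o flift _)).
by congr (flift _ x); apply/funext => t /=; rewrite flift_gen sK.
Qed.

Record complex (K : pzRingType) := Complex {
  cx :> nat -> lmodType K;
  cx_d : forall n, {linear cx n.+1 -> cx n};
  cx_dd : forall n x, cx_d n (cx_d n.+1 x) = 0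
}.
Arguments cx_d {K} c n.

Section Homology.
Variables (K : pzRingType) (X : complex K).

Definition cycles (n : nat) : submodule (X n) :=
  match n with 0 => full_sub (X 0%N) | m.+1 => ker_sub (cx_d X m) end.

(* Boundaries lie in the cycles by cx_dd, so restricting them to the submodule
   of cycles loses nothing. *)
Definition homology (n : nat) : lmodType K :=
  quom (comap_sub (val : {linear subm (cycles n) -> X n}) (im_sub (cx_d X n))).

End Homology.

Record presolution (K : pzRingType) (N : lmodType K) := PResolution {
  pr_cx :> complex K;
  pr_aug : {linear pr_cx 0%N -> N};
  pr_proj : forall n, projective (pr_cx n);
  pr_surj : forall x, exists y, pr_aug y = x;
  pr_exact0 : forall y, pr_aug y = 0 <-> exists z, cx_d pr_cx 0%N z = y;
  pr_exact : forall n y,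
    cx_d pr_cx n y = 0 <-> exists z, cx_d pr_cx n.+1 z = y
}.

(* Each term is the free module on the underlying set of the preceding syzygy
   module. *)
Section StandardResolution.
Variables (K : pzRingType) (N : lmodType K).

Definition feval (V : lmodType K) : {linear freem K V -> V} := flift id.

Fixpoint syzygy (n : nat) : lmodType K :=
  match n with
  | 0 => N
  | m.+1 => subm (ker_sub (feval (syzygy m)))
  end.

Definition std_term (n : nat) : lmodType K := freem K (syzygy n).
Definition std_d (n : nat) : {linear std_term n.+1 -> std_term n} :=
  (val : {linear syzygy n.+1 -> std_term n}) \o feval (syzygy n.+1).

Lemma feval_surj (V : lmodType K) (v : V) : exists y, feval V y = v.
Proof. by exists (fgen v); apply: flift_gen. Qed.

Lemma std_eval n y : feval (syzygy n) (std_d n y) = 0.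
Proof. by rewrite /=; case: (flift _ y) => u /= /sm_predP. Qed.

Lemma std_dd n x : std_d n (std_d n.+1 x) = 0.
Proof. exact: (congr1 val (std_eval x)). Qed.

Lemma std_exact n y :
  feval (syzygy n) y = 0 <-> exists z, std_d n z = y.
Proof.
split=> [y0|[z <-]]; last exact: std_eval.
have [z zE] := feval_surj (Sub y (introT (sm_predP (ker_sub _) y) y0)
                            : syzygy n.+1).
by exists z; rewrite /= -/(feval _ z) zE.
Qed.

Definition std_cx : complex K := Complex std_dd.

Lemma std_cx_exact n y :
  std_d n y = 0 <-> exists z, std_d n.+1 z = y.
Proof.
rewrite -std_exact; split=> [y0|y0]; last exact: (congr1 val y0).
exact: val_inj.
Qed.

Definition std_resolution : presolution N :=
  @PResolution K N std_cx (feval N) (fun n => @free_projective K (syzygy n))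
    (@feval_surj N) (@std_exact 0) std_cx_exact.

End StandardResolution.

(* MathComp's algType R is nontrivial by definition, whereas quotients of an
   algebra may vanish; an R-algebra is therefore a ring, possibly zero, with a
   ring morphism from R to its centre. *)
Record alg (R : comPzRingType) := Alg {
  alg_ring :> pzRingType;
  alg_in : {rmorphism R -> alg_ring};
  alg_central : forall k a, alg_in k * a = a * alg_in k
}.
Arguments alg_in {R} A : rename.

Section AlgMod.
Variables (R : comPzRingType) (A : alg R).

Definition alg_mod : Type := A.
HB.instance Definition _ := GRing.Zmodule.on alg_mod.

Definition alg_scale (k : R) (a : alg_mod) : alg_mod := alg_in A k * (a : A).

Lemma alg_scaleA k l a : alg_scale k (alg_scale l a) = alg_scale (k * l) a.
Proof. by rewrite /alg_scale rmorphM mulrA. Qed.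
Lemma alg_scale1 : left_id 1 alg_scale.
Proof. by move=> a; rewrite /alg_scale rmorph1 mul1r. Qed.
Lemma alg_scaleDr : right_distributive alg_scale +%R.
Proof. by move=> k a b; rewrite /alg_scale mulrDr. Qed.
Lemma alg_scaleDl a : {morph alg_scale^~ a : k l / k + l}.
Proof. by move=> k l; rewrite /alg_scale rmorphD mulrDl. Qed.
HB.instance Definition _ := GRing.Zmodule_isLmodule.Build R alg_mod
  alg_scaleA alg_scale1 alg_scaleDr alg_scaleDl.

End AlgMod.

(* Right S-modules are left modules over the converse ring S^c. *)
Section Tensor.
Variables (R : comPzRingType) (S : alg R) (P : lmodType S^c).

Inductive tensor_rel (N : lmodType S) : set (freem R (P * N)%type) :=
| TensorDl (p p' : P) (x : N) :
    tensor_rel (fgen (p + p', x) - fgen (p, x) - fgen (p', x))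
| TensorDr (p : P) (x x' : N) :
    tensor_rel (fgen (p, x + x') - fgen (p, x) - fgen (p, x'))
| TensorM (p : P) (s : S) (x : N) :
    tensor_rel (fgen ((s : S^c) *: p, x) - fgen (p, s *: x))
| TensorZ (k : R) (p : P) (x : N) :
    tensor_rel (fgen ((alg_in S k : S^c) *: p, x) - k *: fgen (p, x)).

Definition tensor (N : lmodType S) : lmodType R := quom (spanm (@tensor_rel N)).
Definition tens (N : lmodType S) (p : P) (x : N) : tensor N :=
  quom_pi (spanm (@tensor_rel N)) (fgen (p, x)).

Lemma tens_rel0 (N : lmodType S) y : @tensor_rel N y -> quom_pi (spanm (@tensor_rel N)) y = 0.
Proof.
by move=> ry; rewrite -[RHS](linear0 (quom_pi _)); apply/quom_piP;
   rewrite subr0; apply: span_gen.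
Qed.

Lemma tensDl (N : lmodType S) p p' (x : N) : tens (p + p') x = tens p x + tens p' x.
Proof.
apply/eqP; rewrite -subr_eq0 opprD addrA -!linearB.
exact/eqP/tens_rel0/TensorDl.
Qed.
Lemma tensDr (N : lmodType S) p (x x' : N) : tens p (x + x') = tens p x + tens p x'.
Proof.
apply/eqP; rewrite -subr_eq0 opprD addrA -!linearB.
exact/eqP/tens_rel0/TensorDr.
Qed.
Lemma tensM (N : lmodType S) p (s : S) (x : N) :
  tens ((s : S^c) *: p) x = tens p (s *: x).
Proof. by apply/eqP; rewrite -subr_eq0 -linearB; apply/eqP/tens_rel0/TensorM. Qed.
Lemma tensZ (N : lmodType S) (k : R) p (x : N) :
  tens ((alg_in S k : S^c) *: p) x = k *: tens p x.
Proof.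
apply/eqP; rewrite -subr_eq0 -linearZ -linearB.
exact/eqP/tens_rel0/TensorZ.
Qed.

Section TensorMap.
Variables (N N' : lmodType S) (f : {linear N -> N'}).

Definition tensor_pre : {linear freem R (P * N)%type -> tensor N'} :=
  flift (fun px => tens px.1 (f px.2)).

Lemma tensor_pre_rel x :
  spanm (@tensor_rel N) x -> tensor_pre x = 0.
Proof.
apply: (@span_min _ _ _ (ker_sub tensor_pre)) => _ [] * /=;
  rewrite !linearB ?linearZ /= !flift_gen /=.
- by rewrite tensDl -addrA -opprD subrr.
- by rewrite linearD tensDr -addrA -opprD subrr.
- by rewrite linearZ tensM subrr.
- by rewrite tensZ scalerN subrr.
Qed.

Definition tensor_map : {linear tensor N -> tensor N'} :=
  quom_lift tensor_pre_rel.

Lemma tensor_mapE p x : tensor_map (tens p x) = tens p (f x).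
Proof. by rewrite [LHS](quom_liftE tensor_pre_rel) /= flift_gen. Qed.

End TensorMap.

Lemma tensor_linear_ext (N : lmodType S) (V : lmodType R)
  (f g : {linear tensor N -> V}) :
  (forall p x, f (tens p x) = g (tens p x)) -> forall z, f z = g z.
Proof.
move=> fg z; rewrite -[z]quom_reprK; move: (quom_repr z) => y.
rewrite [LHS](flift_unique (f \o quom_pi _)).
rewrite [RHS](flift_unique (g \o quom_pi _)).
by congr (flift _ y); apply/funext => -[p x]; apply: fg.
Qed.

Lemma tensor_dd (F : complex S) n z :
  tensor_map (cx_d F n) (tensor_map (cx_d F n.+1) z) = 0.
Proof.
pose T := tensor_map (cx_d F n) \o tensor_map (cx_d F n.+1).
apply: (@tensor_linear_ext _ _ T \0) => p x.
rewrite [LHS](congr1 (tensor_map _) (tensor_mapE _ _ _)) tensor_mapE cx_dd.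
by apply: (addrI (tens p 0)); rewrite -tensDr !addr0.
Qed.

Definition tensor_cx (F : complex S) : complex R := Complex (@tensor_dd F).

End Tensor.

Definition Tor (R : comPzRingType) (S : alg R) (n : nat)
    (P : lmodType S^c) (N : lmodType S) : lmodType R :=
  homology (tensor_cx P (std_resolution N)) n.

Record ideal (A : pzRingType) := Ideal {
  id_set :> A -> Prop;
  id_0 : id_set 0;
  id_D : forall x y, id_set x -> id_set y -> id_set (x + y);
  id_Ml : forall a x, id_set x -> id_set (a * x);
  id_Mr : forall a x, id_set x -> id_set (x * a)
}.

Section QuotientRing.
Variables (A : pzRingType) (I : ideal A).

Lemma id_lin (a : A) (x y : A^o) : I x -> I y -> I (a *: x + y).
Proof. by move=> Ix Iy; apply: id_D => //; apply: id_Ml. Qed.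
Definition id_sub : submodule A^o :=
  Submodule (sm_set := (I : A^o -> Prop)) (id_0 I) id_lin.

Definition quor : Type := quom id_sub.
HB.instance Definition _ := GRing.Zmodule.on quor.

Definition quor_pi (a : A) : quor := quom_pi id_sub a.
Definition quor_repr (z : quor) : A := quom_repr (z : quom id_sub).

Lemma quor_reprK : cancel quor_repr quor_pi.
Proof. exact: quom_reprK. Qed.
Lemma quor_piP a b : quor_pi a = quor_pi b <-> I (a - b).
Proof. exact: (quom_piP id_sub). Qed.
Lemma quor_piD a b : quor_pi (a + b) = quor_pi a + quor_pi b.
Proof. exact: (quom_piD id_sub). Qed.

Definition quor_mul (y z : quor) : quor :=
  quor_pi (quor_repr y * quor_repr z).

Lemma quor_reprP a : I (a - quor_repr (quor_pi a)).
Proof. by apply/quor_piP; rewrite quor_reprK. Qed.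

Lemma quor_piM a b : quor_pi (a * b) = quor_mul (quor_pi a) (quor_pi b).
Proof.
apply/quor_piP; set a' := quor_repr _; set b' := quor_repr _.
have -> : a * b - a' * b' = (a - a') * b + a' * (b - b').
  by rewrite mulrBl mulrBr addrA subrK.
by apply: id_D; [apply: id_Mr | apply: id_Ml]; apply: quor_reprP.
Qed.

Lemma quor_mulA : associative quor_mul.
Proof.
move=> x y z; rewrite -[x]quor_reprK -[y]quor_reprK -[z]quor_reprK.
by rewrite -!quor_piM mulrA.
Qed.
Lemma quor_mul1l : left_id (quor_pi 1) quor_mul.
Proof. by move=> x; rewrite -[x]quor_reprK -!quor_piM mul1r. Qed.
Lemma quor_mul1r : right_id (quor_pi 1) quor_mul.
Proof. by move=> x; rewrite -[x]quor_reprK -!quor_piM mulr1. Qed.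
Lemma quor_mulDl : left_distributive quor_mul +%R.
Proof.
move=> x y z; rewrite -[x]quor_reprK -[y]quor_reprK -[z]quor_reprK.
by rewrite -quor_piD -!quor_piM -quor_piD mulrDl.
Qed.
Lemma quor_mulDr : right_distributive quor_mul +%R.
Proof.
move=> x y z; rewrite -[x]quor_reprK -[y]quor_reprK -[z]quor_reprK.
by rewrite -quor_piD -!quor_piM -quor_piD mulrDr.
Qed.
HB.instance Definition _ := GRing.Zmodule_isPzRing.Build quor
  quor_mulA quor_mul1l quor_mul1r quor_mulDl quor_mulDr.

Lemma quor_pi_additive : {morph quor_pi : a b / a - b}.
Proof. by move=> a b; exact: (linearB (quom_pi id_sub) a b). Qed.
HB.instance Definition _ :=
  GRing.isZmodMorphism.Build A quor quor_pi quor_pi_additive.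
Lemma quor_pi_monoid : monoid_morphism quor_pi.
Proof. by split=> // a b; apply: quor_piM. Qed.
HB.instance Definition _ :=
  GRing.isMonoidMorphism.Build A quor quor_pi quor_pi_monoid.

Definition killsl (N : lmodType A) : Prop :=
  forall (a : A) (x : N), I a -> a *: x = 0.
Definition killsr (P : lmodType A^c) : Prop :=
  forall (a : A) (x : P), I a -> (a : A^c) *: x = 0.

(* A left (right) A-module killed by I, as a module over A / I. *)
Section Left.
Variables (N : lmodType A) (NI : killsl N).

Definition lquo_mod of killsl N : Type := N.
Local Notation NN := (lquo_mod NI).
HB.instance Definition _ := GRing.Zmodule.on NN.

Definition lquo_scale (z : quor) (x : NN) : NN := quor_repr z *: (x : N).

Lemma lquo_piZ a (x : NN) : lquo_scale (quor_pi a) x = a *: (x : N).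
Proof.
by apply/esym/eqP; rewrite -subr_eq0 -scalerBl NI //; apply: quor_reprP.
Qed.
Lemma lquo_scaleA y z x :
  lquo_scale y (lquo_scale z x) = lquo_scale (y * z) x.
Proof.
rewrite -[y]quor_reprK -[z]quor_reprK -rmorphM.
by rewrite !lquo_piZ scalerA.
Qed.
Lemma lquo_scale1 : left_id 1 lquo_scale.
Proof. by move=> x; rewrite lquo_piZ scale1r. Qed.
Lemma lquo_scaleDr : right_distributive lquo_scale +%R.
Proof. by move=> z x y; rewrite /lquo_scale scalerDr. Qed.
Lemma lquo_scaleDl x : {morph lquo_scale^~ x : y z / y + z}.
Proof.
move=> y z /=; rewrite -[y]quor_reprK -[z]quor_reprK -rmorphD.
by rewrite !lquo_piZ scalerDl.
Qed.
HB.instance Definition _ := GRing.Zmodule_isLmodule.Build quor NN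
  lquo_scaleA lquo_scale1 lquo_scaleDr lquo_scaleDl.
End Left.

Section Right.
Variables (P : lmodType A^c) (PI : killsr P).

Definition rquo_mod of killsr P : Type := P.
Local Notation PP := (rquo_mod PI).
HB.instance Definition _ := GRing.Zmodule.on PP.

Definition rquo_scale (z : quor^c) (x : PP) : PP :=
  (quor_repr z : A^c) *: (x : P).

Lemma rquo_piZ a (x : PP) : rquo_scale (quor_pi a) x = (a : A^c) *: (x : P).
Proof.
by apply/esym/eqP; rewrite -subr_eq0 -scalerBl PI //; apply: quor_reprP.
Qed.
Lemma rquo_scaleA y z x :
  rquo_scale y (rquo_scale z x) = rquo_scale (y * z) x.
Proof.
have -> : y * z = quor_pi (quor_repr z * quor_repr y).
  by rewrite quor_piM !quor_reprK.
by rewrite rquo_piZ /rquo_scale scalerA.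
Qed.
Lemma rquo_scale1 : left_id 1 rquo_scale.
Proof. by move=> x; rewrite rquo_piZ scale1r. Qed.
Lemma rquo_scaleDr : right_distributive rquo_scale +%R.
Proof. by move=> z x y; rewrite /rquo_scale scalerDr. Qed.
Lemma rquo_scaleDl x : {morph rquo_scale^~ x : y z / y + z}.
Proof.
move=> y z /=; have -> : y + z = quor_pi (quor_repr y + quor_repr z).
  by rewrite quor_piD !quor_reprK.
by rewrite rquo_piZ scalerDl.
Qed.
HB.instance Definition _ := GRing.Zmodule_isLmodule.Build quor^c PP
  rquo_scaleA rquo_scale1 rquo_scaleDr rquo_scaleDl.
End Right.

End QuotientRing.

Section QuotientAlg.
Variables (R : comPzRingType) (A : alg R) (I : ideal A).

Lemma quoa_central (k : R) (z : quor I) :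
  (quor_pi I \o alg_in A) k * z = z * (quor_pi I \o alg_in A) k.
Proof. by rewrite -[z]quor_reprK /= -!rmorphM alg_central. Qed.
Definition quoa : alg R := Alg quoa_central.

Definition lquoa_mod (N : lmodType A) (NI : killsl I N) : lmodType quoa :=
  lquo_mod NI.
Definition rquoa_mod (P : lmodType A^c) (PI : killsr I P) : lmodType quoa^c :=
  rquo_mod PI.

End QuotientAlg.

Section Cellular.
Variables (R : comPzRingType) (A : alg R).
Variables (d : Order.disp_t) (L : porderType d).

Section CellSpan.
Variables (G : L -> groupType) (M : L -> finType).
Variable C : forall l : L, M l -> G l -> M l -> A.

Definition cell_index : Type := {l : L & (M l * G l * M l)%type}.
Definition cell_elt (t : cell_index) : alg_mod A :=
  let: existT _ (p, s, q) := t in C p s q.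
Definition cell_span (X : set L) : submodule (alg_mod A) :=
  spanm [set cell_elt t | t in [set t : cell_index | X (projT1 t)]].

End CellSpan.

(* nc_G l may be infinite: nc_fin makes the sum over it in nc_mulC finitely
   supported, as \sum_(s' \in [set: _]) requires. *)
Record naive_cellular := NaiveCellular {
  nc_G : L -> groupType;
  nc_M : L -> finType;
  nc_C : forall l : L, nc_M l -> nc_G l -> nc_M l -> A;
  nc_r : forall l : L, A -> nc_M l -> nc_G l -> nc_M l -> R;
  nc_star : {linear alg_mod A -> alg_mod A};
  nc_C_inj : injective (cell_elt nc_C);
  nc_C_basis : is_basis (range (cell_elt nc_C));
  nc_starK : involutive nc_star;
  nc_starM : forall a b : A, nc_star (a * b : A) = (nc_star b : A) * nc_star a;
  nc_starC : forall (l : L) (p q : nc_M l) (s : nc_G l),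
    nc_star (nc_C p s q) = nc_C q s^-1%g p;
  nc_fin : forall (l : L) (a : A) (p' p : nc_M l),
    finite_set [set s | nc_r a p' s p != 0];
  nc_mulC : forall (l : L) (s : nc_G l) (p q : nc_M l) (a : A),
    cell_span nc_C [set mu | (mu < l)%O]
      (a * nc_C p s q -
       \sum_(s' \in [set: nc_G l]) \sum_(p' : nc_M l)
          nc_r a p' (s' * s^-1)%g p *: (nc_C p' s' q : alg_mod A))
}.

Variable D : naive_cellular.

Definition downward_closed (X : set L) : Prop :=
  forall mu l : L, (mu <= l)%O -> X l -> X mu.

Definition nc_span (X : set L) : submodule (alg_mod A) :=
  cell_span (nc_C (n := D)) X.

Lemma nc_span_gen (X : set L) l (p q : nc_M D l) s :
  X l -> nc_span X (nc_C p s q).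
Proof.
by move=> Xl; apply: span_gen; exists (existT _ l (p, s, q)).
Qed.

Lemma nc_span_min (X : set L) (U : submodule (alg_mod A)) :
  (forall l (p q : nc_M D l) s, X l -> U (nc_C p s q)) ->
  forall x, nc_span X x -> U x.
Proof. by move=> XU; apply: span_min => _ [[l [[p s] q]] Xl <-]; apply: XU. Qed.

Lemma nc_span_mono (X Y : set L) x : Y `<=` X -> nc_span Y x -> nc_span X x.
Proof.
by move=> YX; apply: nc_span_min => l p q s Yl; apply/nc_span_gen/YX.
Qed.

Lemma nc_span_D (X : set L) x y :
  nc_span X x -> nc_span X y -> nc_span X (x + y).
Proof. by rewrite -{2}[x]scale1r; apply: sm_lin. Qed.

Lemma nc_span_star (X : set L) x : nc_span X x -> nc_span X (nc_star D x).
Proof.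
apply: (@nc_span_min X (comap_sub (nc_star D) (nc_span X))) => l p q s Xl /=.
by rewrite nc_starC; apply: nc_span_gen.
Qed.

Definition nc_mull (a : A) (x : alg_mod A) : alg_mod A := a * (x : A).
Lemma nc_mull_linear a : linear (nc_mull a).
Proof.
move=> k x y; rewrite /nc_mull mulrDr; congr (_ + _).
by rewrite [LHS]mulrA -alg_central -mulrA.
Qed.
HB.instance Definition _ a :=
  GRing.isLinear.Build R (alg_mod A) (alg_mod A) _ (nc_mull a)
    (nc_mull_linear a).

Section CellIdeal.
Variables (X : set L) (Xdc : downward_closed X).

Lemma nc_span_Ml (a x : A) : nc_span X x -> nc_span X (a * x : A).
Proof.
apply: (@nc_span_min X (comap_sub (nc_mull a) (nc_span X))) => l p q s Xl.
pose y : alg_mod A := \sum_(s' \in [set: nc_G D l]) \sum_(p' : nc_M D l)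
  nc_r a p' (s' * s^-1)%g p *: (nc_C p' s' q : alg_mod A).
suff : nc_span X ((a * nc_C p s q - y) + y) by rewrite subrK.
apply: nc_span_D.
  apply: nc_span_mono (nc_mulC s p q a) => mu /Order.POrderTheory.ltW/Xdc.
  exact.
rewrite {}/y.
apply: (big_ind (nc_span X)) => [||s' _]; [exact: sm_0|exact: nc_span_D|].
apply: (big_ind (nc_span X)) => [||p' _]; [exact: sm_0|exact: nc_span_D|].
by rewrite -[_ *: _]addr0; apply: sm_lin (sm_0 _); apply: nc_span_gen.
Qed.

Lemma nc_span_Mr (a x : A) : nc_span X x -> nc_span X (x * a : A).
Proof.
move=> Xx; have -> : x * a = nc_star D ((nc_star D a : A) * nc_star D x : A).
  by rewrite nc_starM !nc_starK.
by apply/nc_span_star/nc_span_Ml/nc_span_star.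
Qed.

Definition nc_ideal : ideal A :=
  @Ideal A (nc_span X) (sm_0 _) (@nc_span_D X) nc_span_Ml nc_span_Mr.

End CellIdeal.

Lemma nc_killsl (X Y : set L) (Xdc : downward_closed X)
    (Ydc : downward_closed Y) (YX : Y `<=` X) (N : lmodType A) :
  killsl (nc_ideal Xdc) N -> killsl (nc_ideal Ydc) N.
Proof. by move=> NX a x Ya; apply: NX; apply: nc_span_mono Ya. Qed.

Lemma nc_killsr (X Y : set L) (Xdc : downward_closed X)
    (Ydc : downward_closed Y) (YX : Y `<=` X) (P : lmodType A^c) :
  killsr (nc_ideal Xdc) P -> killsr (nc_ideal Ydc) P.
Proof. by move=> PX a x Ya; apply: PX; apply: nc_span_mono Ya. Qed.

(* The link module, as an R-module: the function v is \sum_p v p C_p. *)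
Definition link_mod (l : L) : lmodType R := {ffun nc_M D l -> R^o}.
Definition link_gen (l : L) (p : nc_M D l) : link_mod l :=
  [ffun p' => (p' == p)%:R : R^o].

(* The coefficient r_{C_{p1,q}^1}(p1, t, p) does not depend on p1; p1 = q is
   used here. *)
Definition link_form_gen (l : L) (t : nc_G D l) (q p : nc_M D l) : R :=
  nc_r (nc_C q 1%g q) q t p.
Definition link_form (l : L) (t : nc_G D l) (u v : link_mod l) : R :=
  \sum_(q : nc_M D l) \sum_(p : nc_M D l) u q * v p * link_form_gen t q p.

End Cellular.
Arguments nc_killsl {R A d L D X Y Xdc} Ydc YX {N} NX : rename.
Arguments nc_killsr {R A d L D X Y Xdc} Ydc YX {P} PX : rename.

(* Main.v *)
(* Adding the elements of X \ Y to Y one at a time, each minimal among those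
   that remain, reduces the theorem to X = Y + {l}. Put S = A / I_Y, T = A / I_X
   and J = ker (S -> T). If v and s are the link vector and the group element
   given for q in M(l), then u_q = \sum_p v_p C_{p,q}^{s^-1} satisfies
   C_{p,q}^t u_q = C_{p,q}^t in S, because the product of C_{p1,q}^{s1} and
   C_{p,q2}^{s2} is \sum_t <C_q, C_p>_t C_{p1,q2}^{s1 t s2}. Hence the
   e_q = u_q^* are idempotents of S with J = (+)_q e_q S, a direct sum of right
   ideals.

   For a free S-resolution F of N the subcomplex J F = (+)_q e_q F is then
   exact, as J N = 0, so T (x)_S F = F / J F is a free T-resolution of N.
   Moreover P (x)_S F = P (x)_T (F / J F), because p (x) e_q y = p e_q (x) y
   and p e_q = 0, and the two Tor's agree by the comparison theorem for
   resolutions. *)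
Require Import Defs.
From HB Require Import structures.
From mathcomp Require Import all_boot all_order all_algebra.
From mathcomp Require Import finmap.
From mathcomp Require Import boolp classical_sets functions cardinality fsbigop.
Set Implicit Arguments.
Unset Strict Implicit.
Unset Printing Implicit Defensive.
Import GRing.Theory.
Local Open Scope ring_scope.
Local Open Scope classical_set_scope.

(** * Linear maps, projective lifting and isomorphisms on homology *)

Definition mklin (K : pzRingType) (V W : lmodType K) (f : V -> W)
    (fl : linear f) : {linear V -> W} :=
  HB.pack f (GRing.isLinear.Build K V W _ f fl).

Section LinearTools.
Variables (K : pzRingType) (V W : lmodType K).

Lemma mod_iso_bij (f : {linear V -> W}) :
  (forall x, f x = 0 -> x = 0) -> (forall y, exists x, f x = y) ->
  mod_iso V W.
Proof.
move=> finj /choice[g gK]; exists f; exists g => [x|y]; last exact: gK.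
apply/eqP; rewrite -subr_eq0; apply/eqP/finj.
by rewrite linearB gK subrr.
Qed.

Lemma mod_iso_refl : mod_iso V V.
Proof. by exists idfun; exists idfun. Qed.

Lemma mod_iso_trans (U : lmodType K) :
  mod_iso U V -> mod_iso V W -> mod_iso U W.
Proof. by move=> [f fb] [g gb]; exists (g \o f); apply: bij_comp. Qed.

(** [projective] lifts along surjections only, so [f] and [g] are first corestricted to the image of
    [g]. *)
Lemma projective_lift (F : lmodType K) (g : {linear V -> W})
    (f : {linear F -> W}) :
  projective F -> (forall x, exists z, g z = f x) ->
  exists h : {linear F -> V}, forall x, g (h x) = f x.
Proof.
move=> Fp fg; pose I := im_sub g.
have gI x : g x \in sm_pred I by apply/sm_predP; exists x.
have fI x : f x \in sm_pred I by apply/sm_predP; apply: fg.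
pose g1 x : subm I := Sub (g x) (gI x).
pose f1 x : subm I := Sub (f x) (fI x).
have g1l : linear g1 by move=> k x y; apply: val_inj; rewrite /= linearP.
have f1l : linear f1 by move=> k x y; apply: val_inj; rewrite /= linearP.
have [|h hE] := Fp _ _ (mklin g1l) (mklin f1l).
  move=> w; have /sm_predP[v vE] := valP w.
  by exists v; apply: val_inj.
by exists h => x; have /(congr1 val) := hE x.
Qed.

End LinearTools.

(** Serves to build chain maps and homotopies degree by degree; [T n] then carries the invariant
    that makes the next lift possible. *)
Lemma dependent_choice (T : nat -> Type) (Q : forall n, T n -> T n.+1 -> Prop)
    (x0 : T 0%N) :
  (forall n x, exists y, Q n x y) ->
  exists f : forall n, T n, f 0%N = x0 /\ forall n, Q n (f n) (f n.+1).
Proof.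
move=> Qt; pose step n x := projT1 (cid (Qt n x)).
exists (nat_rect T x0 step); split=> // n /=.
exact: (projT2 (cid (Qt n _))).
Qed.

(** Injectivity and surjectivity are asked for on representatives, so that applications never handle
    homology classes. *)
Lemma homology_iso (K : pzRingType) (C C' : complex K)
    (f : forall n, {linear C n -> C' n}) (n : nat) :
  (forall m x, f m (cx_d C m x) = cx_d C' m (f m.+1 x)) ->
  (forall z, cycles C n z -> (exists y, cx_d C' n y = f n z) ->
     exists y, cx_d C n y = z) ->
  (forall z, cycles C' n z ->
     exists2 y, cycles C n y & exists w, cx_d C' n w = f n y - z) ->
  mod_iso (homology C n) (homology C' n).
Proof.
move=> fd finj fsurj.
have fcyc x : cycles C n x -> cycles C' n (f n x).
  by case: (n) x => [//|m] x /= xc; rewrite -fd xc linear0.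
have fsub (x : subm (cycles C n)) : f n (val x) \in sm_pred (cycles C' n).
  by apply/sm_predP/fcyc/sm_predP/valP.
pose f1 x : subm (cycles C' n) := Sub (f n (val x)) (fsub x).
have f1l : linear f1 by move=> k x y; apply: val_inj; rewrite /= !linearP.
set B' := comap_sub (val : {linear subm (cycles C' n) -> C' n})
  (im_sub (cx_d C' n)).
pose f2 : {linear subm (cycles C n) -> homology C' n} :=
  quom_pi B' \o mklin f1l.
have f2B x : comap_sub (val : {linear subm (cycles C n) -> C n})
    (im_sub (cx_d C n)) x -> f2 x = 0.
  move=> [y yx]; rewrite -[RHS](linear0 (quom_pi B')); apply/quom_piP.
  by rewrite subr0; exists (f n.+1 y); rewrite -fd yx.
apply: (@mod_iso_bij _ _ _ (quom_lift f2B)) => [z|z].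
  rewrite -[z]quom_reprK; move: (quom_repr z) => x.
  move=> /(etrans (esym (quom_liftE f2B x))).
  rewrite -[RHS](linear0 (quom_pi B')) => /quom_piP.
  rewrite subr0 => -[y yx]; rewrite -[RHS](linear0 (quom_pi _)).
  apply/quom_piP; rewrite subr0; apply: finj; first exact/sm_predP/valP.
  by exists y.
rewrite -[z]quom_reprK; move: (quom_repr z) => x.
have /fsurj[y yc [w wE]] : cycles C' n (val x) by apply/sm_predP/valP.
exists (quom_pi _ (Sub y (introT (sm_predP _ _) yc))).
by rewrite [LHS](quom_liftE f2B); apply/quom_piP; exists w.
Qed.

(** * The comparison theorem for projective resolutions *)

Section Comparison.
Variables (K : pzRingType) (N : lmodType K).

Lemma resolution_map (Q Q' : presolution N) :
  exists f : forall n, {linear Q n -> Q' n},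
    (forall x, pr_aug Q' (f 0%N x) = pr_aug Q x) /\
    forall n x, cx_d Q' n (f n.+1 x) = f n (cx_d Q n x).
Proof.
(* [f] carries boundaries to boundaries, which lets [f \o d] lift through the next differential. *)
pose T n := {f : {linear Q n -> Q' n} |
  forall x, exists z, cx_d Q' n z = f (cx_d Q n x)}.
have [|f0 f0E] := projective_lift (g := pr_aug Q') (f := pr_aug Q)
  (@pr_proj _ _ Q 0%N) _; first by move=> x; apply: pr_surj.
have f0P x : exists z, cx_d Q' 0%N z = f0 (cx_d Q 0%N x).
  by apply/pr_exact0; rewrite f0E; apply/pr_exact0; exists x.
pose Qn n (f : T n) (g : T n.+1) :=
  forall x, cx_d Q' n (sval g x) = sval f (cx_d Q n x).
have [n f|f [fE fS]] := @dependent_choice T Qn (exist _ f0 f0P).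
  have [|g gE] := projective_lift (g := cx_d Q' n)
    (f := sval f \o cx_d Q n) (@pr_proj _ _ Q n.+1) _.
    by move=> x; apply: (svalP f).
  suff gP x : exists z, cx_d Q' n.+1 z = g (cx_d Q n.+1 x).
    by exists (exist _ g gP).
  by apply/pr_exact; rewrite gE /= cx_dd linear0.
exists (fun n => sval (f n)); split=> [x|n x]; last exact: fS.
by rewrite fE /= f0E.
Qed.

Lemma resolution_nullhomotopy (Q : presolution N)
    (h : forall n, {linear Q n -> Q n}) :
  (forall x, pr_aug Q (h 0%N x) = 0) ->
  (forall n x, cx_d Q n (h n.+1 x) = h n (cx_d Q n x)) ->
  exists s : forall n, {linear Q n -> Q n.+1},
    (forall x, cx_d Q 0%N (s 0%N x) = h 0%N x) /\
    forall n x, cx_d Q n.+1 (s n.+1 x) = h n.+1 x - s n (cx_d Q n x).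
Proof.
(* The invariant d s d = h d puts the image of [h n.+1 \- s \o d] into the cycles, hence into the
   boundaries, so that it lifts to the next homotopy. *)
move=> h0 hd; pose T n := {s : {linear Q n -> Q n.+1} |
  forall x, cx_d Q n (s (cx_d Q n x)) = h n (cx_d Q n x)}.
have [|s0 s0E] := projective_lift (g := cx_d Q 0%N) (f := h 0%N)
  (@pr_proj _ _ Q 0%N) _; first by move=> x; apply/pr_exact0.
have s0P x : cx_d Q 0%N (s0 (cx_d Q 0%N x)) = h 0%N (cx_d Q 0%N x) by [].
pose Qn n (s : T n) (t : T n.+1) :=
  forall x, cx_d Q n.+1 (sval t x) = h n.+1 x - sval s (cx_d Q n x).
have [n s|s [sE sS]] := @dependent_choice T Qn (exist _ s0 s0P).
  have [|t tE] := projective_lift (g := cx_d Q n.+1)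
    (f := h n.+1 \- (sval s \o cx_d Q n)) (@pr_proj _ _ Q n.+1) _.
    by move=> x; apply/pr_exact; rewrite /= linearB hd (svalP s) subrr.
  suff tP x : cx_d Q n.+1 (t (cx_d Q n.+1 x)) = h n.+1 (cx_d Q n.+1 x).
    by exists (exist _ t tP).
  by rewrite tE /= cx_dd linear0 subr0.
exists (fun n => sval (s n)); split=> [x|n x]; last exact: sS.
by rewrite sE.
Qed.

End Comparison.

(** * Tensor products and independence of Tor from the resolution *)

Section TensorTools.
Variables (R : comPzRingType) (S : alg R) (P : lmodType S^c).

Lemma tensor_univ (N : lmodType S) (V : lmodType R) (g : P -> N -> V) :
  (forall p p' x, g (p + p') x = g p x + g p' x) ->
  (forall p x x', g p (x + x') = g p x + g p x') ->
  (forall p (s : S) x, g ((s : S^c) *: p) x = g p (s *: x)) ->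
  (forall k p x, g ((alg_in S k : S^c) *: p) x = k *: g p x) ->
  exists f : {linear tensor P N -> V}, forall p x, f (tens p x) = g p x.
Proof.
move=> gDl gDr gM gZ.
pose g1 : {linear freem R (P * N)%type -> V} := flift (fun px => g px.1 px.2).
have g1r x : spanm (@tensor_rel R S P N) x -> g1 x = 0.
  have g1E p y : g1 (fgen (p, y)) = g p y by rewrite [LHS]flift_gen.
  apply: (@span_min _ _ _ (ker_sub g1)) => y yr; apply: (_ : g1 y = 0).
  case: y / yr => [p p' y|p y y'|p r y|k p y];
    rewrite !linearB ?linearZ /= !g1E.
  - by rewrite gDl -addrA -opprD subrr.
  - by rewrite gDr -addrA -opprD subrr.
  - by rewrite gM subrr.
  - by rewrite gZ scalerN subrr.
exists (quom_lift g1r) => p x.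
by rewrite [LHS](quom_liftE g1r) /= flift_gen.
Qed.

Lemma tensor_map_comp (N1 N2 N3 : lmodType S) (f : {linear N1 -> N2})
    (g : {linear N2 -> N3}) p x :
  (tensor_map P g \o tensor_map P f) (tens p x) = tens p (g (f x)).
Proof.
by rewrite [LHS](congr1 (tensor_map P g) (tensor_mapE _ _ _)) tensor_mapE.
Qed.

(** g f lifts the identity of [N], so g f - id = d s + s d for some s; after tensoring with [P] the
    term s d vanishes on cycles. *)
Lemma tensor_homotopy (N : lmodType S) (Q Q' : presolution N)
    (f : forall n, {linear Q n -> Q' n}) (g : forall n, {linear Q' n -> Q n}) :
  (forall x, pr_aug Q' (f 0%N x) = pr_aug Q x) ->
  (forall n x, cx_d Q' n (f n.+1 x) = f n (cx_d Q n x)) ->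
  (forall x, pr_aug Q (g 0%N x) = pr_aug Q' x) ->
  (forall n x, cx_d Q n (g n.+1 x) = g n (cx_d Q' n x)) ->
  forall n z, cycles (tensor_cx P Q) n z ->
  exists w, cx_d (tensor_cx P Q) n w =
    tensor_map P (g n) (tensor_map P (f n) z) - z.
Proof.
move=> f0 fd g0 gd.
have [||s [s0 sS]] := @resolution_nullhomotopy _ _ Q
    (fun n => (g n \o f n) \- idfun).
- by move=> x; rewrite /= linearB g0 f0 subrr.
- by move=> n x; rewrite /= linearB gd fd.
have tB (M : lmodType S) (p : P) (x y : M) :
    tens p (x - y) = tens p x - tens p y.
  by apply/eqP; rewrite eq_sym subr_eq -tensDr subrK.
case=> [|n] z zc.
  exists (tensor_map P (s 0%N) z); move: z {zc}.
  apply: (@tensor_linear_ext _ _ _ _ _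
    (tensor_map P (cx_d Q 0%N) \o tensor_map P (s 0%N))
    ((tensor_map P (g 0%N) \o tensor_map P (f 0%N)) \- idfun)) => p x.
  rewrite [LHS]tensor_map_comp s0 [LHS]tB; congr (_ - _).
  exact/esym/tensor_map_comp.
exists (tensor_map P (s n.+1) z).
(* The subtracted term is zero because [z] is a cycle. With it the equation becomes linear in an
   arbitrary [z], and pure tensors suffice. *)
have -> : tensor_map P (g n.+1) (tensor_map P (f n.+1) z) - z =
    tensor_map P (g n.+1) (tensor_map P (f n.+1) z) - z
      - tensor_map P (s n) (tensor_map P (cx_d Q n) z).
  by rewrite [tensor_map P (cx_d Q n) z]zc linear0 subr0.
move: z {zc}.
apply: (@tensor_linear_ext _ _ _ _ _
    (tensor_map P (cx_d Q n.+1) \o tensor_map P (s n.+1))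
    (((tensor_map P (g n.+1) \o tensor_map P (f n.+1)) \- idfun)
      \- (tensor_map P (s n) \o tensor_map P (cx_d Q n)))) => p x.
rewrite [LHS]tensor_map_comp sS [LHS]tB; congr (_ - _).
  by rewrite [LHS]tB; congr (_ - _); apply/esym/tensor_map_comp.
exact/esym/tensor_map_comp.
Qed.

Lemma homology_tensor_resolution (N : lmodType S) (Q Q' : presolution N) n :
  mod_iso (homology (tensor_cx P Q) n) (homology (tensor_cx P Q') n).
Proof.
have [f [f0 fd]] := resolution_map Q Q'.
have [g [g0 gd]] := resolution_map Q' Q.
have tcomm (C C' : complex S) (h : forall n, {linear C n -> C' n}) :
    (forall n x, cx_d C' n (h n.+1 x) = h n (cx_d C n x)) ->
    forall m x, tensor_map P (h m) (cx_d (tensor_cx P C) m x) =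
      cx_d (tensor_cx P C') m (tensor_map P (h m.+1) x).
  move=> hd m; apply: (@tensor_linear_ext _ _ _ _ _
    (tensor_map P (h m) \o tensor_map P (cx_d C m))
    (tensor_map P (cx_d C' m) \o tensor_map P (h m.+1))) => p x.
  by rewrite [LHS]tensor_map_comp [RHS]tensor_map_comp hd.
apply: (@homology_iso R (tensor_cx P Q) (tensor_cx P Q')
  (fun n => tensor_map P (f n))).
- exact: tcomm.
- move=> z zc [y yE].
  have [w wE] := tensor_homotopy f0 fd g0 gd zc.
  (* If f z = d y and d w = g f z - z, then d (g y - w) = z. *)
  exists (tensor_map P (g n.+1) y - w).
  by rewrite linearB wE -tcomm // yE opprB addrC subrK.
- move=> z zc; exists (tensor_map P (g n) z).
    case: (n) z zc => [//|m] z zc; apply: (etrans (esym (tcomm _ _ _ gd m z))).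
    by rewrite [cx_d (tensor_cx P Q') m z]zc linear0.
  exact: (tensor_homotopy g0 gd f0 fd zc).
Qed.

End TensorTools.

Lemma homology_bij (K : pzRingType) (C C' : complex K)
    (f : forall n, {linear C n -> C' n}) (n : nat) :
  (forall m x, f m (cx_d C m x) = cx_d C' m (f m.+1 x)) ->
  (forall m x, f m x = 0 -> x = 0) -> (forall m y, exists x, f m x = y) ->
  mod_iso (homology C n) (homology C' n).
Proof.
move=> fd finj fsurj; apply: (homology_iso fd) => [z _ [y yE]|z zc].
  have [x xE] := fsurj n.+1 y; exists x; apply/eqP; rewrite -subr_eq0.
  by apply/eqP/(finj n); rewrite linearB fd xE yE subrr.
have [y yE] := fsurj n z; exists y; last first.
  by exists 0; rewrite linear0 yE subrr.
case: (n) z zc y yE => [//|m] z /= zc y yE.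
by apply: (finj m); rewrite fd yE.
Qed.

(** * Change of rings along a surjection of algebras *)

Section Reduction.
Variables (R : comPzRingType) (S T : alg R) (red : {rmorphism S -> T}).
Hypothesis red_surj : forall t, exists s, red s = t.

Definition semilinear_along (V : lmodType S) (W : lmodType T) (h : V -> W) :=
  (forall x y, h (x + y) = h x + h y) /\
  forall (s : S) x, h (s *: x) = red s *: h x.

Lemma semilinear_along0 (V : lmodType S) (W : lmodType T) (h : V -> W) :
  semilinear_along h -> h 0 = 0.
Proof. by move=> [hD _]; apply: (addrI (h 0)); rewrite -hD !addr0. Qed.

Section FreeReduction.
Variable B : choiceType.

Lemma free_red_fin (x : freem S B) :
  has_finsupp (fun t => red (fcoef x t) : (T : pzRingType)^o).
Proof.
apply: sub_finite_set (fcoef_fin x) => t /=.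
by apply: contraNneq => ->; rewrite rmorph0.
Qed.
(** For F free over [S] and J the kernel of [red], this is the projection of F onto F / J F, seen as
    the free [T]-module on the same generators. *)
Definition free_red (x : freem S B) : freem T B :=
  Sub (fun t => red (fcoef x t))
    (introT (sm_predP (Defs.finsupp_sub T B) _) (free_red_fin x)).

Lemma fcoef_red x t : fcoef (free_red x) t = red (fcoef x t).
Proof. by []. Qed.

Lemma free_red_semilinear : semilinear_along free_red.
Proof.
split=> [x y|s x]; apply: fcoef_inj => t.
  by rewrite fcoef_red [LHS]rmorphD.
by rewrite fcoef_red [LHS]rmorphM.
Qed.

Lemma free_red_surj y : exists x, free_red x = y.
Proof.
have [s sE] := choice red_surj.
(* Zero must lift to zero, or the support could become infinite. *)
pose f t := if fcoef y t == 0 then 0 else s (fcoef y t).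
have ff : has_finsupp (f : B -> (S : pzRingType)^o).
  apply: sub_finite_set (fcoef_fin y) => t /=.
  by apply: contraNneq => yt; rewrite /f yt eqxx.
exists (Sub f (introT (sm_predP (Defs.finsupp_sub S B) _) ff)).
apply: fcoef_inj => t; rewrite fcoef_red.
rewrite [fcoef _ t in LHS](erefl : _ = f t) /f.
by case: eqP => [->|_]; rewrite ?rmorph0 ?sE.
Qed.

(** The coefficients of [x] leave [h] as their images under [red], so the composite depends on
    [free_red x] alone. *)
Lemma semilinear_free (V : lmodType S) (W : lmodType T)
    (f : {linear freem S B -> V}) (h : V -> W) x : semilinear_along h ->
  h (f x) = flift (fun b => h (f (fgen b))) (free_red x).
Proof.
move=> hl; have [hD hZ] := hl; have /finite_fsetP[A AE] := fcoef_fin x.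
rewrite flift_unique !(@fliftE _ _ _ _ _ A) ?AE //.
  rewrite (big_morph h hD (semilinear_along0 hl)).
  by apply: eq_bigr => t _; rewrite hZ.
move=> t; rewrite -AE /= fcoef_red.
by apply: contraNneq => ->; rewrite rmorph0.
Qed.

End FreeReduction.

Variables (I : finType) (e : I -> S).
Hypothesis red_e : forall i, red (e i) = 0.
Hypothesis e_idem : forall i, e i * e i = e i.
Hypothesis ker_red : forall s, red s = 0 -> exists a : I -> S,
  s = \sum_i e i * a i.
Hypothesis e_direct : forall a : I -> S, \sum_i e i * a i = 0 ->
  forall i, e i * a i = 0.

(** Each coefficient splits by [ker_red]; its components of index [i], collected over the
    generators, form [y i]. *)
Lemma ker_free_red (B : choiceType) (x : freem S B) : free_red x = 0 ->
  exists y : I -> freem S B, x = \sum_i e i *: y i.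
Proof.
move=> x0; have /choice[a aE] t : exists a, fcoef x t = \sum_i e i * a i.
  by apply: ker_red; rewrite -fcoef_red x0.
have /finite_fsetP[A AE] := fcoef_fin x.
exists (fun i => \sum_(t <- A) a t i *: fgen t).
rewrite -[LHS]free_sum (@fliftE _ _ _ _ _ A) ?AE //.
under [RHS]eq_bigr => i _ do rewrite scaler_sumr.
rewrite [RHS]exchange_big; apply: eq_bigr => t _ /=.
by rewrite {1}aE scaler_suml; apply: eq_bigr => i _; rewrite scalerA.
Qed.

Lemma free_direct (B : choiceType) (y : I -> freem S B) :
  \sum_i e i *: y i = 0 -> forall i, e i *: y i = 0.
Proof.
move=> y0 i; apply: fcoef_inj => t.
have c (r : seq I) : fcoef (\sum_(j <- r) e j *: y j) t =
    \sum_(j <- r) e j * fcoef (y j) t.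
  by elim: r => [|j r IH]; rewrite ?big_nil // !big_cons fcoefP IH.
apply: (e_direct (a := fun i => fcoef (y i) t)).
by rewrite -c y0.
Qed.

Section ReducedResolution.
Variables (N : lmodType S) (N' : lmodType T) (phi : N -> N').
Hypothesis phi_semilinear : semilinear_along phi.
Hypothesis phi_bij : bijective phi.

(* [red_term] is the base change to [T] of the standard resolution of [N]: its
   generators are those of the standard resolution over [S]. *)
Definition red_term (n : nat) : lmodType T := freem T (syzygy N n).
Definition red_d n : {linear red_term n.+1 -> red_term n} :=
  flift (fun b => free_red (std_d N n (fgen b))).
Definition red_aug : {linear red_term 0 -> N'} := flift phi.

Lemma red_dE n x : red_d n (free_red x) = free_red (std_d N n x).
Proof. by rewrite [RHS]semilinear_free //; apply: free_red_semilinear. Qed.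

Lemma red_augE x : red_aug (free_red x) = phi (feval N x).
Proof.
rewrite [RHS]semilinear_free //; congr (flift _ _).
by apply/funext => b; rewrite [feval N _]flift_gen.
Qed.

Lemma free_red0 (B : choiceType) : free_red (0 : freem S B) = 0.
Proof. exact/semilinear_along0/free_red_semilinear. Qed.

Lemma red_dd n x : red_d n (red_d n.+1 x) = 0.
Proof.
have [y <-] := free_red_surj x.
by rewrite !red_dE std_dd free_red0.
Qed.

Lemma red_aug_surj x : exists y, red_aug y = x.
Proof.
have [phi' _ phiK] := phi_bij.
by exists (fgen (phi' x)); rewrite [LHS]flift_gen phiK.
Qed.

Lemma red_exact0 y : red_aug y = 0 <-> exists z, red_d 0 z = y.
Proof.
have phi0 := semilinear_along0 phi_semilinear.
split=> [|[z <-]].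
  have [x <-] := free_red_surj y.
  rewrite red_augE -phi0 => /(bij_inj phi_bij)/(@std_exact _ N 0%N x)[z <-].
  by exists (free_red z); rewrite red_dE.
have [x <-] := free_red_surj z.
by rewrite red_dE red_augE [feval N _](std_eval x).
Qed.

(* Since the sum of the right ideals [e i * S] is direct, a boundary in
   [\sum_i e i *: F] is a sum of boundaries in the [e i *: F]; this gives the
   exactness of the kernel of [free_red] on the standard resolution. *)
Lemma std_boundary_split n (y : I -> std_term N n) :
  (exists x, std_d N n x = \sum_i e i *: y i) ->
  forall i, exists z, std_d N n z = e i *: y i.
Proof.
case: n y => [|n] y [x xE] i.
  (* In degree 0 boundaries are the kernel of the augmentation, and [e i] kills [N] because [phi] is
     injective and [red (e i)] is zero. *)
  apply/(@std_exact _ N 0%N); apply: (bij_inj phi_bij).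
  rewrite linearZ (phi_semilinear.2) red_e scale0r.
  by rewrite (semilinear_along0 phi_semilinear).
apply/std_cx_exact; rewrite linearZ /=.
apply: (free_direct (y := fun i => std_d N n (y i))).
transitivity (std_d N n (\sum_i e i *: y i)); last by rewrite -xE std_dd.
by rewrite linear_sum; apply: eq_bigr => j _; rewrite linearZ.
Qed.

Lemma red_exact n y : red_d n y = 0 <-> exists z, red_d n.+1 z = y.
Proof.
split=> [|[z <-]]; last exact: red_dd.
have [x <-] := free_red_surj y; rewrite red_dE => /ker_free_red[w wE].
have /choice[z zE] := std_boundary_split (ex_intro _ x wE).
(* Multiplying by [e i] once more puts [z'] in the kernel of [free_red], while idempotence keeps d
   z' = d x. So x - z' is a boundary with the same reduction as x. *)
pose z' : std_term N n.+1 := \sum_i e i *: z i.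
have /std_cx_exact[u uE] : std_d N n (x - z') = 0.
  rewrite linearB wE linear_sum -sumrB big1 // => i _.
  rewrite [std_d N n (e i *: z i)]linearZ; apply/eqP; rewrite subr_eq0.
  by apply/eqP; rewrite [RHS](congr1 ( *:%R (e i)) (zE i)) scalerA e_idem.
exists (free_red u); rewrite red_dE uE.
have [rD rZ] := @free_red_semilinear (syzygy N n.+1).
rewrite rD -[RHS]addr0; congr (_ + _).
rewrite -sumrN (big_morph _ rD (free_red0 _)) big1 // => i _.
by rewrite -scalerN rZ red_e scale0r.
Qed.

Definition red_resolution : presolution N' :=
  @PResolution T N' (Complex red_dd) red_aug
    (fun n => @free_projective T (syzygy N n)) red_aug_surj red_exact0
    red_exact.

End ReducedResolution.

Hypothesis red_in : forall k, red (alg_in S k) = alg_in T k.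

Section ReducedTensor.
Variables (P : lmodType S^c) (P' : lmodType T^c) (psi : P -> P').
Hypothesis psiD : forall p q, psi (p + q) = psi p + psi q.
Hypothesis psiZ : forall (s : S) p,
  psi ((s : S^c) *: p) = (red s : T^c) *: psi p.
Hypothesis psi_bij : bijective psi.

(** The difference is a sum of [e i *: z i], and [e i] moves to the left of the tensor sign, where
    it kills [P] because [psi] is injective and [red (e i)] is zero. *)
Lemma tens_free_red (B : choiceType) (p : P) (x y : freem S B) :
  free_red x = free_red y -> tens p x = tens p y.
Proof.
move=> xy; rewrite -[x](subrK y) tensDr -[RHS]add0r; congr (_ + _).
have [|z ->] := @ker_free_red B (x - y).
  have [rD rZ] := @free_red_semilinear B.
  by rewrite rD -scaleN1r rZ rmorphN1 scaleN1r xy subrr.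
have tD (q : P) (a b : freem S B) : tens q (a + b) = tens q a + tens q b.
  exact: tensDr.
have t0 (q : P) : tens q (0 : freem S B) = 0.
  by apply: (addrI (tens q 0)); rewrite -tD !addr0.
rewrite (big_morph _ (tD p) (t0 p)) big1 // => i _; rewrite -tensM.
have -> : (e i : S^c) *: p = 0.
  apply: (bij_inj psi_bij); rewrite psiZ red_e scale0r.
  by apply: (addrI (psi 0)); rewrite -psiD !addr0.
by apply: (addrI (tens 0 (z i))); rewrite -tensDl !addr0.
Qed.

(** The inverse lifts vectors by a set-theoretic section [l] of [free_red]; by [tens_free_red] the
    tensor does not depend on the lift, hence is additive and balanced. *)
Lemma tensor_free_red (B : choiceType) :
  exists f : {linear tensor P (freem S B) -> tensor P' (freem T B)},
    [/\ forall p x, f (tens p x) = tens (psi p) (free_red x),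
        forall z, f z = 0 -> z = 0 & forall z, exists y, f y = z].
Proof.
have [rD rZ] := @free_red_semilinear B.
have [psi' psiK psiK'] := psi_bij.
have [l lK] := choice (@free_red_surj B).
have [||||f fE] := @tensor_univ R S P (freem S B) (tensor P' (freem T B))
  (fun p x => tens (psi p) (free_red x)).
- by move=> p p' x; rewrite psiD tensDl.
- by move=> p x x'; rewrite rD tensDr.
- by move=> p s x; rewrite psiZ rZ tensM.
- by move=> k p x; rewrite psiZ red_in tensZ.
have [||||g gE] := @tensor_univ R T P' (freem T B) (tensor P (freem S B))
  (fun p y => tens (psi' p) (l y)).
- move=> p p' x; rewrite -tensDl; congr (tens _ _).
  by apply: (bij_inj psi_bij); rewrite psiD !psiK'.
- move=> p x x'; rewrite -tensDr; apply: tens_free_red.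
  by rewrite rD !lK.
- move=> p t x; have [s sE] := red_surj t.
  have -> : psi' ((t : T^c) *: p) = (s : S^c) *: psi' p.
    by apply: (bij_inj psi_bij); rewrite psiZ !psiK' sE.
  by rewrite tensM; apply: tens_free_red; rewrite rZ !lK sE.
- move=> k p x; rewrite -tensZ; congr (tens _ _).
  by apply: (bij_inj psi_bij); rewrite psiZ !psiK' red_in.
have fK z : g (f z) = z.
  apply: (@tensor_linear_ext _ _ _ _ _ (g \o f) idfun) => p x /=.
  by rewrite fE gE psiK; apply: tens_free_red; rewrite lK.
have gK z : f (g z) = z.
  apply: (@tensor_linear_ext _ _ _ _ _ (f \o g) idfun) => p x /=.
  by rewrite gE fE psiK' lK.
exists f; split=> // z; last by exists (g z).
by move=> fz; rewrite -[z]fK fz linear0.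
Qed.

Lemma Tor_reduction (N : lmodType S) (N' : lmodType T) (phi : N -> N') n :
  semilinear_along phi -> bijective phi ->
  mod_iso (Tor n P N) (Tor n P' N').
Proof.
move=> phil phib; pose G := red_resolution phil phib.
(* Over [T], Tor is computed from the reduced resolution, whose terms match those over [S] after
   tensoring. *)
apply: mod_iso_trans (homology_tensor_resolution P' G (std_resolution N') n).
have /(_ _)/cid-/all_sig[f fE] m := tensor_free_red (syzygy N m).
apply: (@homology_bij R (tensor_cx P (std_resolution N)) (tensor_cx P' G) f).
- move=> m; apply: (@tensor_linear_ext _ _ _ _ _
    (f m \o tensor_map P (std_d N m))
    (tensor_map P' (red_d N m) \o f m.+1)) => p x.
  have [fm _ _] := fE m; have [fS _ _] := fE m.+1.
  rewrite [LHS](congr1 (f m) (tensor_mapE _ _ _)) fm.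
  rewrite [RHS](congr1 (tensor_map _ _) (fS p x)) tensor_mapE.
  by rewrite red_dE.
- by move=> m; have [_ + _] := fE m.
- by move=> m; have [_ _] := fE m.
Qed.

End ReducedTensor.

End Reduction.

(** * Tor over two quotients of an algebra *)

Section QuotientReduction.
Variables (R : comPzRingType) (A : alg R) (J I : ideal A).
Hypothesis JI : forall a, J a -> I a.

Definition quor_red (z : quor J) : quor I := quor_pi I (quor_repr z).

Lemma quor_red_pi a : quor_red (quor_pi J a) = quor_pi I a.
Proof.
by apply/quor_piP; rewrite -opprB -mulN1r; apply/id_Ml/JI/quor_reprP.
Qed.

Lemma quor_red_additive : {morph quor_red : y z / y - z}.
Proof.
move=> y z; rewrite -[y]quor_reprK -[z]quor_reprK -rmorphB.
by rewrite !quor_red_pi rmorphB.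
Qed.
HB.instance Definition _ :=
  GRing.isZmodMorphism.Build (quor J) (quor I) quor_red quor_red_additive.

Lemma quor_red_monoid : monoid_morphism quor_red.
Proof.
split=> [|y z]; first exact: quor_red_pi.
rewrite -[y]quor_reprK -[z]quor_reprK -rmorphM.
by rewrite !quor_red_pi rmorphM.
Qed.
HB.instance Definition _ :=
  GRing.isMonoidMorphism.Build (quor J) (quor I) quor_red quor_red_monoid.

Lemma quor_pi_eq0 (K : ideal A) a : quor_pi K a = 0 <-> K a.
Proof. by rewrite -[0](rmorph0 (quor_pi K)) quor_piP subr0. Qed.

Lemma Tor_quotient (M : finType) (f : M -> A)
    (P : lmodType A^c) (PJ : killsr J P) (PI : killsr I P)
    (N : lmodType A) (NJ : killsl J N) (NI : killsl I N) n :
  (forall i, I (f i)) -> (forall i, J (f i * f i - f i)) ->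
  (forall a, I a -> exists b : M -> A, J (a - \sum_i f i * b i)) ->
  (forall b : M -> A, J (\sum_i f i * b i) -> forall i, J (f i * b i)) ->
  mod_iso (Tor n (rquoa_mod PJ) (lquoa_mod NJ))
          (Tor n (rquoa_mod PI) (lquoa_mod NI)).
Proof.
move=> If fJ genf dirf.
have piE (b : M -> A) : \sum_i quor_pi J (f i) * quor_pi J (b i) =
    quor_pi J (\sum_i f i * b i).
  by rewrite rmorph_sum; apply: eq_bigr => i _; rewrite rmorphM.
pose red : {rmorphism quor J -> quor I} := quor_red.
have redE a : red (quor_pi J a) = quor_pi I a by exact: quor_red_pi.
(* Both module comparison maps are the identity, as [P] and [N] keep their elements over either
   quotient. *)
apply: (@Tor_reduction R (quoa J) (quoa I) red _ M (fun i => quor_pi J (f i))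
  _ _ _ _ _ (rquoa_mod PJ) (rquoa_mod PI) id _ _ _
  (lquoa_mod NJ) (lquoa_mod NI) id).
- move=> t; exists (quor_pi J (quor_repr t)).
  by rewrite redE quor_reprK.
- by move=> i; rewrite redE; apply/quor_pi_eq0.
- by move=> i; rewrite -rmorphM; apply/quor_piP.
- move=> s; rewrite -[s]quor_reprK redE => /quor_pi_eq0/genf[b bE].
  exists (fun i => quor_pi J (b i)); rewrite [RHS]piE.
  exact/quor_piP.
- move=> a a0 i; rewrite -[a i]quor_reprK -rmorphM; apply/quor_pi_eq0.
  apply: (dirf (fun i => quor_repr (a i))); apply/quor_pi_eq0.
  by rewrite -piE -[RHS]a0; apply: eq_bigr => j _; rewrite quor_reprK.
- by move=> k; exact: redE.
- by [].
- move=> s p; rewrite -[s]quor_reprK redE.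
  exact: etrans (rquo_piZ _ (p : rquo_mod PJ))
    (esym (rquo_piZ _ (p : rquo_mod PI))).
- by exists id.
- split=> // s x; rewrite -[s]quor_reprK redE.
  exact: etrans (lquo_piZ _ (x : lquo_mod NJ))
    (esym (lquo_piZ _ (x : lquo_mod NI))).
- by exists id.
Qed.

End QuotientReduction.

(** * Coordinates in the cellular basis *)

Lemma basis_coord (K : pzRingType) (V : lmodType K) (T : choiceType)
    (c : T -> V) :
  injective c -> is_basis (range c) ->
  exists cf : T -> {linear V -> K^o},
    (forall t u, cf t (c u) = (t == u)%:R) /\
    forall x, exists s : seq T, x = \sum_(t <- s) (cf t x : K) *: c t.
Proof.
(* The linear extension of [c] to the free module is bijective; coordinates are the coefficients of
   the preimage. *)
move=> cinj [cgen cfree]; pose E : {linear freem K T -> V} := flift c.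
have Ec t : E (fgen t) = c t by exact: flift_gen.
have Esurj x : exists y, E y = x.
  have [n [k [v [vr ->]]]] := cgen x.
  have /choice[t tE] i : exists t, c t = v i.
    by have [t _ <-] := vr i; exists t.
  exists (\sum_(i < n) k i *: fgen (t i)); rewrite linear_sum.
  apply: eq_bigr => i _; rewrite linearZ; congr (_ *: _).
  by rewrite Ec tE.
have Einj y : E y = 0 -> y = 0.
  have /finite_fsetP[A AE] := fcoef_fin y.
  rewrite [E y](@fliftE _ _ _ _ _ A) ?AE // big_tnth => y0.
  apply: fcoef_inj => t; apply/eqP; apply: contraT => yt.
  have tA : t \in A by have : [set` A] t by rewrite -AE.
  (* Independence in [is_basis] concerns injective families indexed by ordinals, so the support of
     [y] is enumerated. *)
  pose v i := c (tnth (in_tuple A) i).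
  have vinj : injective v.
    by move=> i j /cinj/tuple_uniqP; apply; apply: fset_uniq.
  have vr i : range c (v i) by exists (tnth (in_tuple A) i).
  have /tnthP[i tE] : t \in in_tuple A by [].
  by rewrite tE (cfree _ _ v vinj vr y0 i) eqxx in yt.
have [g gK] := choice Esurj.
have gl : linear g.
  move=> k x y; apply/eqP; rewrite -subr_eq0; apply/eqP/Einj.
  by rewrite linearB linearP !gK subrr.
have gc t : g (c t) = fgen t.
  apply/eqP; rewrite -subr_eq0; apply/eqP/Einj.
  by rewrite linearB gK Ec subrr.
have cl t : linear (fun x => fcoef (g x) t : K^o).
  by move=> k x y; rewrite gl fcoefP.
exists (fun t => mklin (cl t)); split=> [t u|x].
  by rewrite /= gc fcoef_gen.
have /finite_fsetP[A AE] := fcoef_fin (g x); exists A.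
by rewrite -{1}[x]gK [LHS](@fliftE _ _ _ _ _ A) ?AE.
Qed.

Section CellularCoordinates.
Variables (R : comPzRingType) (A : alg R) (d : Order.disp_t).
Variables (L : porderType d) (D : naive_cellular A L).

Definition cellix : choiceType :=
  {l : L & (nc_M D l * nc_G D l * nc_M D l)%type}.
Definition cellix_mk l (p : nc_M D l) (s : nc_G D l) (q : nc_M D l) : cellix :=
  existT _ l (p, s, q).

Lemma cellix_mk_eq l (p p' : nc_M D l) s s' q q' :
  (cellix_mk p s q == cellix_mk p' s' q') = [&& p == p', s == s' & q == q'].
Proof. by rewrite /cellix_mk eq_Tagged /= !xpair_eqE andbA. Qed.

Lemma nc_coef_exists : exists cf : cellix -> {linear alg_mod A -> R^o},
  (forall t u, cf t (cell_elt (nc_C (n := D)) u) = (t == u)%:R) /\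
  forall x, exists s : seq cellix,
    x = \sum_(t <- s) (cf t x : R) *: (cell_elt (nc_C (n := D)) t : alg_mod A).
Proof. by apply: basis_coord; [apply: nc_C_inj | apply: nc_C_basis]. Qed.

Definition nc_coef : cellix -> {linear alg_mod A -> R^o} :=
  projT1 (cid nc_coef_exists).

Lemma nc_coefC t l (p q : nc_M D l) s :
  nc_coef t (nc_C p s q) = (t == cellix_mk p s q)%:R.
Proof. exact: (projT2 (cid nc_coef_exists)).1 t (cellix_mk p s q). Qed.

Lemma nc_coef_sum x : exists s : seq cellix,
  x = \sum_(t <- s) (nc_coef t x : R) *:
    (cell_elt (nc_C (n := D)) t : alg_mod A).
Proof. exact: (projT2 (cid nc_coef_exists)).2. Qed.

Lemma nc_linear_ext (V : lmodType R) (f g : {linear alg_mod A -> V}) :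
  (forall l (p q : nc_M D l) s, f (nc_C p s q) = g (nc_C p s q)) -> f =1 g.
Proof.
move=> fg x; have [s ->] := nc_coef_sum x; rewrite !linear_sum.
by apply: eq_bigr => -[l [[p s'] q]] _; rewrite !linearZ /= fg.
Qed.

Lemma nc_spanP (X : set L) x :
  nc_span D X x <-> forall t, ~ X (projT1 t) -> nc_coef t x = 0.
Proof.
split=> [Xx t tX|x0].
  apply: (@nc_span_min _ _ _ _ D X (ker_sub (nc_coef t))) Xx => l p q s Xl.
  by rewrite /= nc_coefC; case: eqP tX => [->|].
have [s ->] := nc_coef_sum x.
apply: (big_ind (nc_span D X)) => [||t _]; [exact: sm_0|exact: nc_span_D|].
have [tX|tX] := pselect (X (projT1 t)); last first.
  by rewrite (x0 _ tX) scale0r; apply: sm_0.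
rewrite -[_ *: _]addr0; apply: sm_lin (sm_0 _).
by case: t tX => l [[p s'] q]; apply: nc_span_gen.
Qed.

Definition cellix_star (t : cellix) : cellix :=
  let: existT _ (p, s, q) := t in cellix_mk q s^-1%g p.

Lemma cellix_starK : involutive cellix_star.
Proof. by move=> [l [[p s] q]]; rewrite /= /cellix_mk invgK. Qed.

Lemma nc_coef_star t x : nc_coef t (nc_star D x) = nc_coef (cellix_star t) x.
Proof.
apply: (@nc_linear_ext _ (nc_coef _ \o nc_star D) (nc_coef _)) => l p q s /=.
rewrite nc_starC !nc_coefC -[LHS](congr1 (fun b : bool => b%:R)
  (inj_eq (can_inj cellix_starK) _ _)) /=.
by rewrite /cellix_mk invgK.
Qed.

(** The error term of [nc_mulC] lies in cells strictly below [l], so its coefficients in the cell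
    [l] vanish. *)
Lemma nc_coefMC l (p' p q q' : nc_M D l) s' s a :
  nc_coef (cellix_mk p' s' q') (a * nc_C p s q : A) =
    (q' == q)%:R * nc_r a p' (s' * s^-1)%g p.
Proof.
pose y : alg_mod A := \sum_(t \in [set: nc_G D l]) \sum_(r : nc_M D l)
  nc_r a r (t * s^-1)%g p *: (nc_C r t q : alg_mod A).
have -> : a * nc_C p s q = (a * nc_C p s q - y) + y by rewrite subrK.
have /nc_spanP y0 : nc_span D [set mu | (mu < l)%O] (a * nc_C p s q - y).
  exact: nc_mulC.
rewrite linearD y0 ?add0r /= ?Order.POrderTheory.ltxx // {y0}.
(* [B] holds [s'] and every group element with a nonzero term, which makes the sum over a possibly
   infinite group finite. *)
have /finite_fsetP[B BE] : finite_set
    ([set s'] `|` \bigcup_(r in [set: nc_M D l])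
      [set t | nc_r a r (t * s^-1)%g p != 0]).
  rewrite finite_setU; split=> //; apply: bigcup_finite => // r _.
  apply: sub_finite_set (finite_image (fun t => t * s)%g (nc_fin a r p)).
  move=> t rt; exists (t * s^-1)%g; first exact: rt.
  exact: mulgVK.
rewrite /y (fsbigTE B); last first.
  move=> t tB; rewrite big1 // => r _.
  have [->|rt] := eqVneq (nc_r a r (t * s^-1)%g p) 0.
    by rewrite scale0r.
  case/negP: tB; have : [set` B] t by rewrite -BE; right; exists r.
  by [].
have s'B : s' \in B by have : [set` B] s' by rewrite -BE; left.
rewrite linear_sum (bigD1_seq s') ?fset_uniq //= [X in _ + X]big1 => [|t ts].
  rewrite addr0 linear_sum (bigD1 p') //= big1 => [|r rp].
    by rewrite addr0 linearZ /= nc_coefC cellix_mk_eq !eqxx mulrC.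
  by rewrite linearZ /= nc_coefC cellix_mk_eq eq_sym (negPf rp) [LHS]mulr0.
rewrite linear_sum big1 // => r _; rewrite linearZ /= nc_coefC cellix_mk_eq.
by rewrite [s' == t]eq_sym (negPf ts) andbF [LHS]mulr0.
Qed.

(** The coefficient of C_{p',q2}^t in C_{p1,q}^{s1} C_{p,q2}^1 is computed twice: with the left
    factor acting, and with the starred right factor acting. *)
Lemma nc_r_swap l (p1 q p' p q2 : nc_M D l) s1 t :
  nc_r (nc_C p1 s1 q) p' t p =
    (p' == p1)%:R * nc_r (nc_C q2 1%g p) q2 (t^-1 * s1)%g q.
Proof.
have := nc_coefMC p' p q2 q2 t 1%g (nc_C p1 s1 q).
rewrite eqxx mul1r invg1 mulg1 => <-.
have -> : nc_C p1 s1 q * nc_C p 1%g q2 =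
    nc_star D (nc_C q2 1%g p * nc_C q s1^-1%g p1 : A).
  by rewrite nc_starM !nc_starC invgK invg1.
by rewrite nc_coef_star nc_coefMC invgK.
Qed.

(** By [nc_r_swap] both sides reduce to the action of C_{p,p}^1, where [p1] no longer occurs; hence
    the link form does not depend on [p1]. *)
Lemma nc_r_link_form l (p1 q p' p : nc_M D l) s t :
  nc_r (nc_C p1 s q) p' t p = (p' == p1)%:R * link_form_gen (s^-1 * t)%g q p.
Proof.
rewrite (nc_r_swap _ _ _ _ p) /link_form_gen (nc_r_swap q q q p p).
by rewrite eqxx mul1r mulg1 invgM invgK.
Qed.

Section Unit.
Variables (l : L) (q : nc_M D l) (v : link_mod D l) (s0 : nc_G D l).
Hypothesis form_v : forall t,
  link_form t (link_gen q) v = if t == s0 then 1 else 0.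

(** This is u_q; the inverse of [s0] cancels the group element at which the form of C_q and [v] is
    1. *)
Definition cell_unit : alg_mod A :=
  \sum_(p : nc_M D l) (v p : R) *: (nc_C p s0^-1%g q : alg_mod A).

Lemma cell_unit_span (X : set L) : X l -> nc_span D X cell_unit.
Proof.
move=> Xl; apply: (big_ind (nc_span D X)) => [||p _]; first exact: sm_0.
  exact: nc_span_D.
by rewrite -[_ *: _]addr0; apply: sm_lin (sm_0 _); apply: nc_span_gen.
Qed.

Lemma link_form_genl t :
  \sum_(p : nc_M D l) (v p : R) * link_form_gen t q p = (t == s0)%:R.
Proof.
transitivity (link_form t (link_gen q) v); last by rewrite form_v; case: eqP.
rewrite /link_form [RHS](bigD1 q) //= [X in _ + X]big1 => [|q' q'q].
  by rewrite addr0; apply: eq_bigr => p _; rewrite ffunE eqxx mul1r.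
by apply: big1 => p _; rewrite ffunE (negPf q'q) !mul0r.
Qed.

Lemma nc_coefM_unit (p' q' : nc_M D l) s' a :
  nc_coef (cellix_mk p' s' q') (a * cell_unit : A) =
    (q' == q)%:R * \sum_(p : nc_M D l) (v p : R) * nc_r a p' (s' * s0)%g p.
Proof.
rewrite -/(nc_mull a cell_unit) linear_sum linear_sum mulr_sumr.
apply: eq_bigr => p _.
rewrite linearZ linearZ [nc_coef _ _]nc_coefMC invgK.
by rewrite [LHS]mulrCA.
Qed.

Lemma nc_coefCM_unit (p1 p' q' : nc_M D l) s s' :
  nc_coef (cellix_mk p' s' q') (nc_C p1 s q * cell_unit : A) =
  nc_coef (cellix_mk p' s' q') (nc_C p1 s q).
Proof.
rewrite nc_coefM_unit nc_coefC cellix_mk_eq.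
under eq_bigr => p _ do rewrite nc_r_link_form mulrCA.
rewrite -mulr_sumr link_form_genl mulgA.
(* The form contributes 1 exactly when s^-1 s' s0 = s0, that is when s' = s. *)
rewrite -{2}[s0]mul1g (inj_eq (mulIg s0)) mulg_eq1 eqg_inv [s == s']eq_sym.
by case: (p' == p1) (s' == s) (q' == q) => [] [] []; rewrite !(mul1r, mul0r).
Qed.

End Unit.

End CellularCoordinates.

(** * Adding one cell to the ideal *)

Section AddCell.
Variables (R : comPzRingType) (A : alg R) (d : Order.disp_t).
Variables (L : porderType d) (D : naive_cellular A L).
Variables (Y : set L) (l : L).
Local Notation Z := (Y `|` [set l]).
Hypothesis Ydc : downward_closed Y.
Hypothesis Zdc : downward_closed Z.
Hypothesis Yl : ~ Y l.

Lemma nc_spanB (X : set L) x y :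
  nc_span D X x -> nc_span D X y -> nc_span D X (x - y).
Proof. by move=> Xx Xy; rewrite -scaleN1r addrC; apply: sm_lin. Qed.

(** [Y] and [Z] differ in [l] alone, so congruences modulo I_Y between elements of I_Z are checked
    on the cell [l]. *)
Lemma nc_span_cell x : nc_span D Z x ->
  (forall (p q : nc_M D l) s, nc_coef (cellix_mk p s q) x = 0) ->
  nc_span D Y x.
Proof.
move=> /nc_spanP Zx lx; apply/nc_spanP => t Yt.
have [[//|/= tl]|Zt] := pselect (Z (projT1 t)); last exact: Zx.
by case: t tl {Yt} => m [[p s] q] /= ml; subst m; apply: lx.
Qed.

Variables (v : nc_M D l -> link_mod D l) (s0 : nc_M D l -> nc_G D l).
Hypothesis form_v : forall q t,
  link_form t (link_gen q) (v q) = if t == s0 q then 1 else 0.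

Local Notation u q := (cell_unit q (v q) (s0 q) : A).
(** This is e_q; the anti-involution turns the right unit u_q into a left unit. *)
Definition cell_idem q : A := nc_star D (u q).

Lemma nc_CM_unit (p q : nc_M D l) s :
  nc_span D Y ((nc_C p s q : A) * u q - nc_C p s q : A).
Proof.
have ZC : nc_span D Z (nc_C p s q) by apply: nc_span_gen; right.
apply: nc_span_cell => [|p' q' s'].
  by apply: nc_spanB => //; apply: nc_span_Mr.
by rewrite linearB /= (nc_coefCM_unit (form_v q)) subrr.
Qed.

Lemma cell_idem_span q : nc_span D Z (cell_idem q).
Proof. by apply/nc_span_star/cell_unit_span; right. Qed.

(** u_q is a combination of elements C_{p,q}^t, each fixed modulo I_Y by right multiplication by
    u_q. *)
Lemma cell_idemM q : nc_span D Y (cell_idem q * cell_idem q - cell_idem q : A).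
Proof.
rewrite /cell_idem -nc_starM -(linearB (nc_star D)); apply: nc_span_star.
have -> : (u q * u q : A) - u q = \sum_p (v q p : R) *:
    ((nc_C p (s0 q)^-1%g q : A) * u q - nc_C p (s0 q)^-1%g q : alg_mod A).
  rewrite -[in LHS]/(cell_unit q (v q) (s0 q) : alg_mod A).
  under eq_bigr => p _ do rewrite scalerBr.
  rewrite sumrB; congr (_ - _); rewrite {1}/cell_unit mulr_suml.
  by apply: eq_bigr => p _; rewrite -[LHS]mulrA.
apply: (big_ind (nc_span D Y)) => [||p _]; first exact: sm_0.
  exact: nc_span_D.
by rewrite -[_ *: _]addr0; apply: sm_lin (sm_0 _); apply: nc_CM_unit.
Qed.

Lemma cell_idemC (p q : nc_M D l) s :
  nc_span D Y (nc_C q s p - cell_idem q * nc_C q s p : A).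
Proof.
have -> : (nc_C q s p : A) - cell_idem q * nc_C q s p =
    nc_star D (- ((nc_C p s^-1%g q : A) * u q - nc_C p s^-1%g q)).
  by rewrite opprB linearB /= nc_starM nc_starC invgK.
apply: nc_span_star; rewrite -sub0r; apply: nc_spanB; first exact: sm_0.
exact: nc_CM_unit.
Qed.

Lemma cell_idem_gen a : nc_span D Z a ->
  exists b : nc_M D l -> A, nc_span D Y (a - \sum_q cell_idem q * b q : A).
Proof.
pose U (x : alg_mod A) := exists b : nc_M D l -> A,
  nc_span D Y (x - \sum_q cell_idem q * b q : A).
have U0 : U 0.
  exists (fun=> 0); rewrite big1 ?subrr => [|q _]; last exact: mulr0.
  exact: sm_0.
have Ulin k x y : U x -> U y -> U (k *: x + y).
  move=> [b bx] [c cy]; exists (fun q => k *: (b q : alg_mod A) + c q).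
  have -> : \sum_q cell_idem q * (k *: (b q : alg_mod A) + c q : A) =
      k *: (\sum_q cell_idem q * b q : alg_mod A) + \sum_q cell_idem q * c q.
    rewrite scaler_sumr -big_split; apply: eq_bigr => q _.
    exact: (linearP (nc_mull (cell_idem q))).
  rewrite opprD addrACA -scalerBr; exact: sm_lin.
apply: (@nc_span_min _ _ _ _ D Z (Submodule U0 Ulin)) => m p q s [Ym|ml].
  exists (fun=> 0); rewrite big1 ?subr0 => [|r _]; last exact: mulr0.
  exact: nc_span_gen.
move: ml p q s => -> p q s.
(* A basis element in row [p] of the cell is fixed by [cell_idem p] modulo I_Y. *)
exists (fun r => if r == p then nc_C p s q else 0).
rewrite (bigD1 p) //= eqxx big1 => [|r /negPf->]; last exact: mulr0.
by rewrite addr0; apply: cell_idemC.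
Qed.

(** Within the cell [l], e_q A lives in row q alone; this separates the summands in
    [cell_idem_direct]. *)
Lemma nc_coef_idemM q p' q' s' a : p' != q ->
  nc_coef (cellix_mk p' s' q') (cell_idem q * a : A) = 0.
Proof.
move=> p'q; have -> : cell_idem q * a = nc_star D ((nc_star D a : A) * u q : A).
  by rewrite nc_starM nc_starK.
by rewrite nc_coef_star nc_coefM_unit (negPf p'q) [LHS]mul0r.
Qed.

Lemma cell_idem_direct (b : nc_M D l -> A) :
  nc_span D Y (\sum_q cell_idem q * b q : A) ->
  forall q, nc_span D Y (cell_idem q * b q : A).
Proof.
move=> /nc_spanP Yb q; apply: nc_span_cell => [|p q' s].
  exact/nc_span_Mr/cell_idem_span.
have [->|pq] := eqVneq p q; last exact: nc_coef_idemM.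
(* The coefficient of the whole sum vanishes as [l] is not in [Y], and only the summand of index [q]
   reaches row [q]. *)
have := Yb (cellix_mk q s q') Yl.
rewrite linear_sum (bigD1 q) //= big1 ?addr0 // => r rq.
by apply: nc_coef_idemM; rewrite eq_sym.
Qed.

Lemma Tor_add_cell (P : lmodType A^c) (N : lmodType A)
    (PY : killsr (nc_ideal D Ydc) P) (PZ : killsr (nc_ideal D Zdc) P)
    (NY : killsl (nc_ideal D Ydc) N) (NZ : killsl (nc_ideal D Zdc) N) n :
  mod_iso (Tor n (rquoa_mod PY) (lquoa_mod NY))
          (Tor n (rquoa_mod PZ) (lquoa_mod NZ)).
Proof.
apply: (@Tor_quotient R A (nc_ideal D Ydc) (nc_ideal D Zdc) _ _ cell_idem).
- by move=> a; apply: nc_span_mono; left.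
- exact: cell_idem_span.
- exact: cell_idemM.
- exact: cell_idem_gen.
- exact: cell_idem_direct.
Qed.

End AddCell.

(** * Induction on the elements of X outside Y *)

Lemma seq_minimal (d : Order.disp_t) (L : porderType d) (x : L) (s : seq L) :
  exists2 m, m \in x :: s & forall y, y \in x :: s -> ~~ (y < m)%O.
Proof.
elim: s x => [|a s IH] x.
  by exists x; rewrite ?mem_head // => y; rewrite inE => /eqP->;
    rewrite Order.POrderTheory.ltxx.
have [m ms mmin] := IH a; have [xm|xm] := boolP (x < m)%O.
  exists x; first exact: mem_head.
  move=> y; rewrite inE => /predU1P[->|/mmin].
    by rewrite Order.POrderTheory.ltxx.
  by apply: contra => yx; apply: Order.POrderTheory.lt_trans xm.
exists m; first by rewrite inE ms orbT.
by move=> y; rewrite inE => /predU1P[->//|/mmin].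
Qed.

Theorem theorem1p1 (R : comPzRingType) (A : alg R)
    (d : Order.disp_t) (L : porderType d) (D : naive_cellular A L)
    (X Y : set L) (Xdc : downward_closed X) (Ydc : downward_closed Y)
    (YX : Y `<=` X) (XYfin : finite_set (X `\` Y))
    (XYform : forall l : L, (X `\` Y) l -> forall q : nc_M D l,
       exists v : link_mod D l, exists s : nc_G D l, forall t : nc_G D l,
         link_form t (link_gen q) v = if t == s then 1 else 0)
    (P : lmodType A^c) (N : lmodType A)
    (PX : killsr (nc_ideal D Xdc) P) (NX : killsl (nc_ideal D Xdc) N)
    (n : nat) :
  mod_iso
    (Tor n (rquoa_mod (nc_killsr Ydc YX PX)) (lquoa_mod (nc_killsl Ydc YX NX)))
    (Tor n (rquoa_mod PX) (lquoa_mod NX)).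
Proof.
(* Induction on a bound for the length of a list enumerating X \ Y, for all [Y] at once. *)
have /finite_seqP[s sE] := XYfin; move: (leqnn (size s)) sE.
move: {2}(size s) => m; elim: m Y s Ydc YX XYfin XYform => [|m IH].
  move=> Y s Ydc YX _ _; rewrite leqn0 => /nilP-> XY.
  have YE : Y = X.
    apply/seteqP; split=> // x Xx; apply: contrapT => Yx.
    by have : (X `\` Y) x by []; rewrite XY.
  (* The two Tor's still differ in the proofs of closedness and annihilation that they contain. *)
  subst Y; rewrite (Prop_irrelevance Ydc Xdc).
  rewrite (Prop_irrelevance (nc_killsr Xdc YX PX) PX).
  rewrite (Prop_irrelevance (nc_killsl Xdc YX NX) NX).
  exact: mod_iso_refl.
move=> Y [|x s] Ydc YX XYfin XYform sm XY.
  exact: (IH Y [::]).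
have [l ls lmin] := seq_minimal x s.
have [Xl Yl] : (X `\` Y) l by rewrite XY.
pose Z := Y `|` [set l].
have ZX : Z `<=` X by move=> y [/YX|->].
(* An element strictly below [l] lies in X, and by minimality of [l] it cannot lie outside [Y]. *)
have Zdc : downward_closed Z.
  move=> y z yz [Yz|zl]; first by left; apply: Ydc Yz.
  rewrite {}zl in yz; have [->|yl] := eqVneq y l; first by right.
  left; apply: contrapT => Yy.
  have /lmin/negP[] : y \in x :: s.
    have : (X `\` Y) y by split=> //; exact: (Xdc y l).
    by rewrite XY.
  by rewrite Order.POrderTheory.lt_neqAle yl.
have XZ y : (X `\` Z) y -> (X `\` Y) y.
  by move=> [Xy Zy]; split=> // Yy; apply: Zy; left.
have /choice[v /choice[s0 form_v]] := XYform l (conj Xl Yl).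
apply: mod_iso_trans (Tor_add_cell Yl form_v _ (nc_killsr Zdc ZX PX) _
  (nc_killsl Zdc ZX NX) n) _.
apply: (IH Z [seq y <- x :: s | y != l]).
- exact: sub_finite_set XYfin.
- by move=> k /XZ; apply: XYform.
- rewrite -ltnS; apply: leq_trans sm; rewrite size_filter ltn_neqAle.
  rewrite count_size andbT -all_count; apply/allPn; exists l => //.
  by rewrite eqxx.
- apply/seteqP; split=> y; rewrite /mkset mem_filter.
    move=> XZy; have : (X `\` Y) y by apply: XZ.
    rewrite XY /= => ->; rewrite andbT; apply/eqP => yl.
    by case: XZy => _; apply; right.
  move=> /andP[/eqP yl ys]; have [Xy Yy] : (X `\` Y) y by rewrite XY.
  by split=> // -[].
Qed.
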